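(* Let $n\ge 2$. There exists a twice differentiable hypersurface in $\mathbb{R}^{n+1}$ that is not $C^2$, but whose mean curvature is continuous and whose second fundamental form is bounded.
   Context: A hypersurface in $\mathbb{R}^{n+1}$ is twice differentiable (respectively $C^2$) if it is locally, up to a rigid motion, the graph of a twice differentiable (respectively $C^2$) function of $n$ variables. For the graph of a twice differentiable function $u$ the mean curvature is $$H=\operatorname{div}\left(\frac{\nabla u}{\sqrt{1+|\nabla u|^2}}\right)=\frac{\Delta u}{\sqrt{1+|\nabla u|^2}}-\sum_{i,j=1}^n\frac{\frac{\partial u}{\partial x_i}\frac{\partial u}{\partial x_j}\frac{\partial^2u}{\partial x_i\partial x_j}}{\left(\sqrt{1+|\nabla u|^2}\right)^3},$$ and the second fundamental form is given by the matrix $\dfrac{D^2u}{\sqrt{1+|\nabla u|^2}}$, where $D^2u$ is the Hessian of $u$. *)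

(* Defs.v *)
From HB Require Import structures.
From mathcomp Require Import all_boot all_order all_algebra.
From mathcomp Require Import all_classical all_reals all_analysis.
Set Implicit Arguments.
Unset Strict Implicit.
Unset Printing Implicit Defensive.
Import Order.TTheory GRing.Theory Num.Theory.
Import numFieldNormedType.Exports.
Local Open Scope classical_set_scope.
Local Open Scope ring_scope.

Section EuclideanCalculus.
Context {R : realType} {n : nat}.
Implicit Types (u : 'rV[R]_n -> R) (x : 'rV[R]_n) (D : set 'rV[R]_n).

(* The norm `|_| of the library on 'rV[R]_n is the sup norm, hence this. *)
Definition dot (x y : 'rV[R]_n) : R := (x *m y^T) 0 0.

Definition partial (i : 'I_n) (f : 'rV[R]_n -> R) x : R :=
  'D_(delta_mx 0 i) f x.

Definition grad u x : 'rV[R]_n := \row_i partial i u x.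

Definition divergence (F : 'rV[R]_n -> 'rV[R]_n) x : R :=
  \sum_(i < n) partial i (fun y => F y 0 i) x.

Definition hessian u x : 'M[R]_n :=
  \matrix_(i, j) partial i (partial j u) x.

(* Both predicates are meant for open D. *)
Definition twice_differentiable_on D u : Prop :=
  forall x, D x -> differentiable u x /\ differentiable (grad u) x.

Definition C2_on D u : Prop :=
  twice_differentiable_on D u /\
  (forall x, D x -> {for x, continuous (hessian u)}).

Definition area_factor u x : R := Num.sqrt (1 + dot (grad u x) (grad u x)).

Definition mean_curvature u x : R :=
  divergence (fun y => (area_factor u y)^-1 *: grad u y) x.

(* Matrices of the second and first fundamental forms of the graph of u in the
   basis of tangent vectors (e_i, partial i u x). *)
Definition second_form u x : 'M[R]_n := (area_factor u x)^-1 *: hessian u x.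

Definition first_form u x : 'M[R]_n := 1%:M + (grad u x)^T *m grad u x.

(* Euclidean length in R^(n+1) of the tangent vector with coordinates v, that
   is, of (v, dot (grad u x) v). *)
Definition tangent_norm u x (v : 'rV[R]_n) : R :=
  Num.sqrt (dot (v *m first_form u x) v).

End EuclideanCalculus.

Section Hypersurface.
Context {R : realType} {n : nat}.
Implicit Types (S : set 'rV[R]_(n + 1)).

(* The image of the graph of [height] over [dom] under the rigid motion
   z |-> z *m rot + shift, to be compared with S inside [window]. *)
Record patch := Patch {
  rot : 'M[R]_(n + 1);
  shift : 'rV[R]_(n + 1);
  window : set 'rV[R]_(n + 1);
  dom : set 'rV[R]_n;
  height : 'rV[R]_n -> R }.

Definition patch_point (P : patch) (x : 'rV[R]_n) : 'rV[R]_(n + 1) :=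
  row_mx x (height P x)%:M *m rot P + shift P.

Definition is_patch S (P : patch) : Prop :=
  [/\ rot P *m (rot P)^T = 1%:M, open (window P), open (dom P) &
      S `&` window P = patch_point P @` dom P].

Definition twice_differentiable_patch S (P : patch) : Prop :=
  is_patch S P /\ twice_differentiable_on (dom P) (height P).

Definition twice_differentiable_hypersurface S : Prop :=
  forall p, S p ->
    exists2 P, twice_differentiable_patch S P & window P p.

Definition C2_hypersurface S : Prop :=
  forall p, S p ->
    exists P, [/\ is_patch S P, C2_on (dom P) (height P) & window P p].

(* The mean curvature of S is determined up to the choice of a local unit
   normal; each local graph representation fixes one (the one pointing along
   the graph axis), so continuity is required in all of them. *)
Definition continuous_mean_curvature S : Prop :=
  forall P, twice_differentiable_patch S P ->
  forall x, dom P x -> {for x, continuous (mean_curvature (height P))}.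

(* A single bound on the norm of the second fundamental form, as a bilinear
   form on the tangent spaces with their Euclidean norm.  The entries of its
   matrix in a tilted graph representation depend on the tilt, this norm does
   not. *)
Definition bounded_second_form S : Prop :=
  exists C : R, forall P, twice_differentiable_patch S P ->
  forall x, dom P x -> forall v w : 'rV[R]_n,
  `|dot (v *m second_form (height P) x) w| <=
    C * tangent_norm (height P) x v * tangent_norm (height P) x w.

End Hypersurface.

(* Main.v *)
Require Import Defs.
From mathcomp Require Import all_boot all_order all_algebra.
From mathcomp Require Import all_classical all_reals all_analysis.
From mathcomp Require Import ring lra.
Set Implicit Arguments.
Unset Strict Implicit.
Unset Printing Implicit Defensive.
Import Order.TTheory GRing.Theory Num.Theory.
Import numFieldNormedType.Exports.
Local Open Scope classical_set_scope.
Local Open Scope ring_scope.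

(** Where the gradient is small the mean curvature is close to the Laplacian, and
a small Laplacian does not make the other second derivatives small.
Near a point, with X and Y two Cartesian coordinates centred there, the
function X Y has mixed derivative 1.  Multiplying it by a cutoff that is a
function of a * ln (d + X^2 + Y^2) turns it off within a tiny disc: each
derivative of the cutoff carries a factor a, and the denominators d + X^2 + Y^2
that appear are compensated by the factors X and Y.  The result is a C^2 bump
with mixed derivative 1 at the centre, bounded second derivatives, and
Laplacian O(a) ([bump_hess_center], [norm_bump_hess], [norm_bump_trace]).

The height function puts one such bump, with parameter a, at distance a from
the hyperplane x_0 = 0 for every a = 2^-k, in a disc of radius at most a^2 / 4,
the remaining coordinates being ignored.  The discs are so small that the
height is O(x_0^2) and its gradient too, hence both are flat on x_0 = 0 and the
Hessian exists and vanishes there ([has_grad_flat]).  Away from the hyperplane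
the height locally coincides with a single bump or with zero ([height_local]).
So it is twice differentiable, with bounded Hessian; the Laplacian is O(x_0),
and since the gradient is O(x_0^2) the nonlinear part of the mean curvature is
also continuous across x_0 = 0.  The Hessian is not: its (0, 1) entry is 1 at
the centres of the bumps, which accumulate at the origin.

The required properties concern all local graph representations of the surface,
tilted ones included.  If the graphs of h and h' represent the same piece of
surface up to a rotation Q, the coordinates of the second representation are an
explicit affine function of (y, h y), so the change of charts inherits the
regularity of h without an implicit function theorem.  Differentiating twice
the identity that expresses h' in the new coordinates yields the
transformation law lambda * D^2 h = J (D^2 h') J^T, where J is the Jacobian of
the change of charts and lambda the factor between the non-normalized normals
([hessian_transition]).  Together with the orthogonality of Q it gives the
invariance of the norm of the second fundamental form
([second_form_transition]), that of the mean curvature up to a sign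
([mean_curvature_transition]), and the fact that the Hessian is continuous in
one representation when it is in the other ([hessian_overlap]). *)

(** * Calculus in coordinates *)

Section Calculus.
Context {R : realType}.

Lemma near_eq_differentiable (V W : normedModType R) (f g : V -> W) x :
  (\near x, f x = g x) -> differentiable f x -> differentiable g x.
Proof.
move=> fg df; have fgx := nbhs_singleton fg.
have [dc /eqaddoP hf] := (diff_locallyP _ _).1 df.
have E : g \o shift x = cst (g x) + 'd f x +o_ 0 id.
  apply/eqaddoP => e e0; have := hf e e0.
  have fg0 := fg; rewrite (near_shift 0 x) subr0 in fg0.
  apply: filter_app; apply: filter_app fg0; near=> h => /= E1.
  by rewrite !fctE /= !fgx ?subr0 in E1 *; rewrite E1.
have D := diff_unique dc E.
by apply/diff_locallyP; split; rewrite D.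
Unshelve. all: by end_near. Qed.

Lemma continuous_mx m p (T : topologicalType) (M : T -> 'M[R]_(m, p)) x :
  (forall i j, {for x, continuous (fun y => M y i j)}) ->
  {for x, continuous M}.
Proof.
move=> h A [P Pn sPA].
rewrite nbhs_simpl /=; near=> y; apply: sPA; near: y.
by apply: filter_forall => i; apply: filter_forall => j; exact: h (Pn i j).
Unshelve. all: by end_near. Qed.

Lemma near_eq_continuous (T U : topologicalType) (f g : T -> U) x :
  (\near x, f x = g x) -> {for x, continuous f} -> {for x, continuous g}.
Proof.
move=> fg cf; rewrite /prop_for /continuous_at -(nbhs_singleton fg).
by apply: cvg_trans cf; apply: near_eq_cvg.
Qed.

Lemma continuous_sum_at (T : topologicalType) m (f : 'I_m -> T -> R) x :
  (forall k, {for x, continuous (f k)}) ->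
  {for x, continuous (fun y => \sum_(k < m) f k y)}.
Proof.
elim: m f => [|m IH] f cf.
  rewrite (_ : (fun y => _) = cst 0); first exact: cst_continuous.
  by apply/funext => y; rewrite big_ord0.
rewrite (_ : (fun y => _) = fun y =>
  \sum_(k < m) f (widen_ord (leqnSn m) k) y + f ord_max y).
  apply: continuousD => //; exact: IH.
by apply/funext => y; rewrite big_ord_recr.
Qed.

Lemma continuous_mulmx (T : topologicalType) m p q (A : T -> 'M[R]_(m, p))
    (B : T -> 'M[R]_(p, q)) x :
  {for x, continuous A} -> {for x, continuous B} ->
  {for x, continuous (fun y => A y *m B y)}.
Proof.
move=> cA cB; apply: continuous_mx => i j.
rewrite (_ : (fun y => _) = fun y => \sum_k A y i k * B y k j); last first.
  by apply/funext => y; rewrite mxE.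
apply: continuous_sum_at => k; apply: continuousM.
  exact: continuous_comp cA (@coord_continuous _ _ _ i k _).
exact: continuous_comp cB (@coord_continuous _ _ _ k j _).
Qed.

Lemma continuous_trmx (T : topologicalType) m p (A : T -> 'M[R]_(m, p)) x :
  {for x, continuous A} -> {for x, continuous (fun y => (A y)^T)}.
Proof.
move=> cA; apply: continuous_mx => i j.
rewrite (_ : (fun y => _) = fun y => A y j i); last first.
  by apply/funext => y; rewrite mxE.
exact: continuous_comp cA (@coord_continuous _ _ _ j i _).
Qed.

End Calculus.

Section Gradients.
Context {R : realType}.

Lemma differentiable_row (V : normedModType R) m (F : V -> 'rV[R]_m) x :
  (forall k, differentiable (fun y => F y 0 k) x) -> differentiable F x.
Proof.
move=> dF.
have -> : F = \sum_(k < m) (fun y => F y 0 k *: (delta_mx 0 k : 'rV[R]_m)).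
  apply/funext => y; rewrite fct_sumE; exact: row_sum_delta.
by apply: differentiable_sum => k; exact: differentiableZl.
Qed.

Section has_grad.
Context {n : nat}.
Implicit Types (f : 'rV[R]_n -> R) (x : 'rV[R]_n).

Lemma partialE i f x : differentiable f x -> partial i f x = 'd f x (delta_mx 0 i).
Proof. exact: deriveE. Qed.

Lemma partial_near i f g x : (\near x, f x = g x) -> partial i f x = partial i g x.
Proof. exact: near_eq_derive. Qed.

Lemma diff_partial f x v : differentiable f x ->
  'd f x v = \sum_(i < n) v 0 i * partial i f x.
Proof.
move=> df; rewrite {1}(row_sum_delta v) linear_sum.
by apply: eq_bigr => i _; rewrite linearZ partialE.
Qed.

(** Differentiability is kept together with the values of the partials because
the existence of partials alone would not be stable under composition. *)
Definition has_grad f x (g : 'I_n -> R) : Prop :=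
  differentiable f x /\ forall i, partial i f x = g i.

Lemma has_grad_eq f x g g' : has_grad f x g -> g =1 g' -> has_grad f x g'.
Proof. by move=> [df E] gg'; split=> // i; rewrite E. Qed.

Lemma has_grad_near f f' x g :
  (\near x, f x = f' x) -> has_grad f x g -> has_grad f' x g.
Proof.
move=> ff' [df E]; split; first exact: near_eq_differentiable ff' df.
by move=> i; rewrite -E; apply/esym/partial_near.
Qed.

Lemma has_grad_cst c x : has_grad (fun=> c) x (fun=> 0).
Proof.
split=> [|i]; first exact: differentiable_cst.
by rewrite partialE ?diff_cst //; exact: differentiable_cst.
Qed.

Lemma has_grad_coord k x : has_grad (fun y => y 0 k) x (fun i => (k == i)%:R).
Proof.
have df := differentiable_coord x 0 k; split=> // i.
have @L : {linear 'rV[R]_n -> R}.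
  by exists (fun y : 'rV[R]_n => y 0 k); do 2![eexists]; do ?[constructor];
     rewrite ?mxE// => ? *; rewrite ?mxE//; move=> ?; rewrite !mxE.
have E : (fun y : 'rV[R]_n => y 0 k) = L by [].
by rewrite partialE // E diff_lin /= ?mxE //; exact: coord_continuous.
Qed.

Lemma has_gradD f1 f2 x g1 g2 : has_grad f1 x g1 -> has_grad f2 x g2 ->
  has_grad (fun y => f1 y + f2 y) x (fun i => g1 i + g2 i).
Proof.
move=> [d1 E1] [d2 E2]; have d12 := differentiableD d1 d2; split=> // i.
by rewrite -E1 -E2 !partialE // [in LHS]diffD.
Qed.

Lemma has_gradM f1 f2 x g1 g2 : has_grad f1 x g1 -> has_grad f2 x g2 ->
  has_grad (fun y => f1 y * f2 y) x (fun i => f1 x * g2 i + f2 x * g1 i).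
Proof.
move=> [d1 E1] [d2 E2]; have d12 := differentiableM d1 d2; split=> // i.
by rewrite -E1 -E2 !partialE // [in LHS]diffM.
Qed.

Lemma has_gradZ c f x g :
  has_grad f x g -> has_grad (fun y => c * f y) x (fun i => c * g i).
Proof.
move=> h; apply: has_grad_eq (has_gradM (has_grad_cst c x) h) _ => i.
by rewrite mulr0 addr0.
Qed.

Lemma has_gradB f1 f2 x g1 g2 : has_grad f1 x g1 -> has_grad f2 x g2 ->
  has_grad (fun y => f1 y - f2 y) x (fun i => g1 i - g2 i).
Proof.
move=> [d1 E1] [d2 E2]; have d12 := differentiableB d1 d2; split=> // i.
by rewrite -E1 -E2 !partialE // [in LHS]diffB.
Qed.

Lemma has_grad_sum m (f : 'I_m -> 'rV[R]_n -> R) x (g : 'I_m -> 'I_n -> R) :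
  (forall k, has_grad (f k) x (g k)) ->
  has_grad (fun y => \sum_(k < m) f k y) x (fun i => \sum_(k < m) g k i).
Proof.
move=> fg; elim: m f g fg => [|m IH] f g fg.
  under eq_fun do rewrite big_ord0.
  by apply: has_grad_eq (has_grad_cst 0 x) _ => i; rewrite big_ord0.
under eq_fun do rewrite big_ord_recr.
apply: has_grad_eq (has_gradD (IH _ _ (fun k => fg (widen_ord (leqnSn m) k)))
  (fg ord_max)) _ => i; by rewrite big_ord_recr.
Qed.

Lemma has_grad_comp1 f x g (F : R -> R) dF : has_grad f x g ->
  is_derive (f x) 1 F dF -> has_grad (fun y => F (f y)) x (fun i => dF * g i).
Proof.
move=> [df E] [dF1 EF]; have dFx := (derivable1_diffP _ _).1 dF1.
have dc : differentiable (F \o f) x by exact: differentiable_comp.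
split=> // i; rewrite partialE // [in LHS]diff_comp //= -partialE // E.
by rewrite [in LHS]deriv1E //= derive1E EF [_ *: _]mulrC.
Qed.

Lemma has_gradV f x g : f x != 0 -> has_grad f x g ->
  has_grad (fun y => (f y)^-1) x (fun i => - (f x) ^- 2 * g i).
Proof.
move=> fx0 [df E]; have dV := differentiableV df fx0; split=> // i.
by rewrite -E !partialE // [in LHS]diffV.
Qed.

End has_grad.

(** The chain rule for a change of variables: 'd f is evaluated on the rows of the
Jacobian by linearity, through its values on the coordinate vectors. *)
Lemma has_grad_comp n m (f : 'rV[R]_m -> R) (p : 'rV[R]_n -> 'rV[R]_m) x
    (g : 'I_m -> R) (dp : 'I_m -> 'I_n -> R) :
  has_grad f (p x) g -> (forall k, has_grad (fun y => p y 0 k) x (dp k)) ->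
  has_grad (fun y => f (p y)) x (fun i => \sum_(k < m) dp k i * g k).
Proof.
move=> [df E] dpx.
have dpx' : differentiable p x by apply: differentiable_row => k; have [] := dpx k.
have dc : differentiable (f \o p) x by exact: differentiable_comp.
split=> // i; rewrite partialE // [in LHS]diff_comp //= diff_partial //.
apply: eq_bigr => k _; rewrite E; congr (_ * _).
have [dk <-] := dpx k; rewrite partialE //.
have := has_grad_coord k (p x) => -[dck Ek].
rewrite (_ : (fun y => p y 0 k) = (fun z : 'rV[R]_m => z 0 k) \o p) //.
rewrite [in RHS]diff_comp //= diff_partial // (bigD1 k) //= Ek eqxx mulr1.
rewrite big1 ?addr0 // => l lk; rewrite Ek (negbTE (_ : k != l)) ?mulr0 //.
by rewrite eq_sym.
Qed.

End Gradients.

(** * Curvature of a graph in coordinates *)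

Section Forms.
Context {R : realType} {n : nat}.
Implicit Types (u : 'rV[R]_n -> R) (x g : 'rV[R]_n) (H : 'M[R]_n).

Lemma dotE x y : dot x y = \sum_(i < n) x 0 i * y 0 i.
Proof. by rewrite /dot mxE; apply: eq_bigr => i _; rewrite mxE. Qed.

Lemma dot_ge0 x : 0 <= dot x x.
Proof. by rewrite dotE; apply: sumr_ge0 => i _; rewrite -expr2 sqr_ge0. Qed.

Lemma area_factor_sqr u x :
  area_factor u x ^+ 2 = 1 + dot (grad u x) (grad u x).
Proof. by rewrite sqr_sqrtr // addr_ge0 // dot_ge0. Qed.

Lemma area_factor_gt0 u x : 0 < area_factor u x.
Proof. by rewrite sqrtr_gt0 ltr_pwDl // dot_ge0. Qed.

(** Twice differentiability in terms of partials: the Hessian collects the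
gradients of the entries of the gradient. *)
Lemma has_grad_partial u x j : differentiable (grad u) x ->
  has_grad (fun y => grad u y 0 j) x (fun i => hessian u x i j).
Proof.
move=> dg; split.
  exact: (differentiable_comp dg (differentiable_coord (grad u x) 0 j)).
move=> i; rewrite mxE; congr (partial i _ x); apply/funext => y.
by rewrite mxE.
Qed.

(** The Sherman-Morrison formula for the inverse of 1 + g^T g. *)
Definition inv_first_form g : 'M[R]_n :=
  1%:M - (1 + dot g g)^-1 *: (g^T *m g).

Lemma has_grad_area u x : differentiable (grad u) x ->
  has_grad (area_factor u) x (fun i =>
    (area_factor u x)^-1 * \sum_k grad u x 0 k * hessian u x i k).
Proof.
move=> dg.
have hs : has_grad (fun y => 1 + dot (grad u y) (grad u y)) x
    (fun i => 2 * \sum_k grad u x 0 k * hessian u x i k).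
  under eq_fun do rewrite dotE.
  apply: has_grad_eq (has_gradD (has_grad_cst 1 x) (has_grad_sum
    (fun k => has_gradM (has_grad_partial k dg) (has_grad_partial k dg)))) _.
  move=> i; rewrite add0r mulr_sumr; apply: eq_bigr => k _; ring.
have s0 : 0 < 1 + dot (grad u x) (grad u x) by rewrite ltr_pwDl // dot_ge0.
apply: has_grad_eq (has_grad_comp1 hs (is_derive1_sqrt s0)) _ => i.
by rewrite -/(area_factor u x); field; exact: lt0r_neq0 (area_factor_gt0 u x).
Qed.

(** Expanding the divergence gives the trace of the second form with respect to
the first one; it is this form that transforms well under changes of chart. *)
Lemma mean_curvatureE u x : differentiable (grad u) x ->
  mean_curvature u x = (area_factor u x)^-1 *
    \tr (inv_first_form (grad u x) *m hessian u x).
Proof.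
move=> dg; rewrite /mean_curvature /divergence.
have W0 := lt0r_neq0 (area_factor_gt0 u x).
have E i : partial i (fun y => ((area_factor u y)^-1 *: grad u y) 0 i) x =
  (area_factor u x)^-1 * (hessian u x i i -
   (area_factor u x) ^- 2 * \sum_k grad u x 0 i * grad u x 0 k * hessian u x i k).
  rewrite (_ : (fun y => _) = fun y => (area_factor u y)^-1 * grad u y 0 i);
    last by apply/funext => y; rewrite mxE.
  have [_ ->] := has_gradM (has_gradV W0 (has_grad_area dg)) (has_grad_partial i dg).
  have -> : \sum_k grad u x 0 i * grad u x 0 k * hessian u x i k =
      grad u x 0 i * \sum_k grad u x 0 k * hessian u x i k.
    by rewrite mulr_sumr; apply: eq_bigr => k _; rewrite mulrA.
  by field; exact: W0.
under eq_bigr do rewrite E.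
rewrite -mulr_sumr; congr (_ * _).
rewrite /inv_first_form mulmxBl mul1mx raddfB /= -scalemxAl mxtraceZ.
rewrite sumrB -mulr_sumr -area_factor_sqr; congr (_ - _ * _).
rewrite -mulmxA mxtrace_mulC /mxtrace big_ord_recl big_ord0 addr0 mxE.
rewrite exchange_big /=; apply: eq_bigr => k _.
rewrite !mxE mulr_suml; apply: eq_bigr => i _; ring.
Qed.

Lemma first_form_inv g : (1%:M + g^T *m g) *m inv_first_form g = 1%:M.
Proof.
have s0 : 1 + dot g g != 0 by rewrite lt0r_neq0 // ltr_pwDl // dot_ge0.
rewrite /inv_first_form mulmxBr mulmx1 -scalemxAr mulmxDl mul1mx.
have -> : g^T *m g *m (g^T *m g) = dot g g *: (g^T *m g).
  rewrite -mulmxA (mulmxA g) (mx11_scalar (g *m g^T)) mul_scalar_mx.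
  by rewrite -scalemxAr.
set M := g^T *m g; have -> : M + dot g g *: M = (1 + dot g g) *: M.
  by rewrite scalerDl scale1r.
by rewrite scalerA mulVf // scale1r addrK.
Qed.

End Forms.

(** The effect of an orthogonal matrix Q that carries the tangent space of a graph
with gradient g to that of a graph with gradient g'.  The hypothesis gg' says
that rotated tangent vectors lie in the second tangent space; the rows of J are
their coordinates in its basis. *)
Section FormChange.
Context {R : realType} {n : nat}.
Implicit Types (g : 'rV[R]_n) (Q : 'M[R]_(n + 1)).

(** The rows are the tangent vectors (e_i, g_i) of a graph with gradient g. *)
Definition tangent_basis g : 'M[R]_(n, n + 1) := row_mx 1%:M g^T.
Definition upward_normal g : 'rV[R]_(n + 1) := row_mx (- g) 1%:M.

Variables (Q : 'M[R]_(n + 1)) (g g' : 'rV[R]_n).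
Hypothesis QQ : Q *m Q^T = 1%:M.

Let J := tangent_basis g *m lsubmx Q.
Hypothesis gg' : tangent_basis g *m rsubmx Q = J *m g'^T.
Let lambda := (upward_normal g' *m Q^T) 0 (rshift n 0).

Lemma tangent_basis_change : tangent_basis g *m Q = J *m tangent_basis g'.
Proof. by rewrite mul_mx_row mulmx1 -gg' -mul_mx_row hsubmxK. Qed.

Lemma first_form_change :
  1%:M + g^T *m g = J *m (1%:M + g'^T *m g') *m J^T.
Proof.
have E (z : 'rV[R]_n) : 1%:M + z^T *m z = tangent_basis z *m (tangent_basis z)^T.
  by rewrite tr_row_mx mul_row_col !trmx1 mulmx1 trmxK.
have -> : J *m (1%:M + g'^T *m g') *m J^T =
    J *m tangent_basis g' *m (J *m tangent_basis g')^T.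
  by rewrite E [(J *m tangent_basis g')^T]trmx_mul !mulmxA.
by rewrite E -tangent_basis_change trmx_mul -mulmxA (mulmxA Q) QQ mul1mx.
Qed.

(** A vector orthogonal to the rows of tangent_basis g is determined by its last
coordinate, and rotating back the second normal gives such a vector. *)
Lemma normal_change : upward_normal g' *m Q^T = lambda *: upward_normal g.
Proof.
set v := upward_normal g' *m Q^T.
have vE : v = row_mx (lsubmx v) lambda%:M.
  rewrite -[LHS]hsubmxK; congr (row_mx _ _).
  by rewrite [LHS]mx11_scalar mxE.
have tv : tangent_basis g *m v^T = 0.
  rewrite trmx_mul trmxK mulmxA tangent_basis_change -mulmxA.
  by rewrite tr_row_mx mul_row_col mul1mx trmx1 mulmx1 raddfN /= addNr mulmx0.
move: tv; rewrite vE tr_row_mx mul_row_col mul1mx tr_scalar_mx mul_mx_scalar.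
move/eqP; rewrite addr_eq0 => /eqP/(congr1 trmx); rewrite trmxK => ->.
by rewrite /upward_normal scale_row_mx raddfN /= linearZ /= trmxK scalerN
  scale_scalar_mx mulr1.
Qed.

Lemma upward_normal_sqr (z : 'rV[R]_n) :
  upward_normal z *m (upward_normal z)^T = (1 + dot z z)%:M.
Proof.
rewrite tr_row_mx mul_row_col raddfN /= mulNmx mulmxN opprK trmx1 mulmx1.
by rewrite (mx11_scalar (z *m _)) -raddfD addrC.
Qed.

(** Rotations preserve the length of the normal, which is the area factor. *)
Lemma area_change : lambda ^+ 2 * (1 + dot g g) = 1 + dot g' g'.
Proof.
have /(congr1 (fun M : 'M[R]_1 => M 0 0)) := upward_normal_sqr g'.
have -> : upward_normal g' *m (upward_normal g')^T =
    (upward_normal g' *m Q^T) *m (upward_normal g' *m Q^T)^T.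
  by rewrite trmx_mul trmxK mulmxA -(mulmxA _ Q^T) (mulmx1C QQ) mulmx1.
rewrite normal_change linearZ /= -scalemxAl -scalemxAr scalerA upward_normal_sqr.
by rewrite !mxE eqxx !mulr1n -expr2.
Qed.

(** J is invertible because the first form is, so the factors J in the two forms
cancel inside the trace. *)
Lemma trace_change (H H' : 'M[R]_n) : lambda *: H = J *m H' *m J^T ->
  lambda * \tr (inv_first_form g *m H) = \tr (inv_first_form g' *m H').
Proof.
move=> HH.
have ff := first_form_inv g; have ff' := first_form_inv g'.
rewrite first_form_change in ff.
have fJ : J^T *m inv_first_form g *m J = inv_first_form g'.
  have E : J *m ((1%:M + g'^T *m g') *m (J^T *m inv_first_form g)) = 1%:M.
    by rewrite !mulmxA.
  move/mulmx1C: E; rewrite -!mulmxA => E; move/mulmx1C: ff' => ff'.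
  rewrite -[LHS]mul1mx -ff' -!mulmxA.
  by rewrite E mulmx1.
rewrite -mxtraceZ scalemxAr HH mulmxA mxtrace_mulC.
by rewrite -fJ !mulmxA.
Qed.

End FormChange.

(** * Change of graph representation *)

Section Transition.
Context {R : realType} {n : nat}.
Variables (h h' : 'rV[R]_n -> R) (Q : 'M[R]_(n + 1)) (s : 'rV[R]_(n + 1)).

(** The points of the graph of h, moved by a rigid motion; chart, jac and tilt are
the change of charts it induces, its Jacobian, and the factor lambda of
normal_change. *)
Definition moved y : 'rV[R]_(n + 1) := row_mx y (h y)%:M *m Q + s.
Definition chart y : 'rV[R]_n := lsubmx (moved y).
Definition jac y : 'M[R]_n := tangent_basis (grad h y) *m lsubmx Q.
Definition tilt y : R :=
  (upward_normal (grad h' (chart y)) *m Q^T) 0 (rshift n 0).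

Lemma has_grad_moved y k : differentiable h y ->
  has_grad (fun y => moved y 0 k) y
    (fun i => (tangent_basis (grad h y) *m Q) i k).
Proof.
move=> dh.
have hl (l : 'I_(n + 1)) : has_grad (fun y => row_mx y (h y)%:M 0 l) y
    (fun i => tangent_basis (grad h y) i l).
  rewrite -[l]splitK; case: (fintype.split l) => j /=.
    under eq_fun do rewrite row_mxEl.
    apply: has_grad_eq (has_grad_coord j y) _ => i.
    by rewrite row_mxEl mxE eq_sym.
  under eq_fun do rewrite row_mxEr [j]ord1 mxE eqxx mulr1n.
  by split=> // i; rewrite row_mxEr !mxE.
rewrite (_ : (fun y => moved y 0 k) =
    fun y => \sum_l Q l k * row_mx y (h y)%:M 0 l + s 0 k); last first.
  apply/funext => z; rewrite !mxE; congr (_ + _).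
  by apply: eq_bigr => l _; rewrite mulrC.
apply: has_grad_eq (has_gradD (has_grad_sum (fun l => has_gradZ (Q l k) (hl l)))
  (has_grad_cst _ _)) _ => i.
by rewrite addr0 mxE; apply: eq_bigr => l _; rewrite mulrC.
Qed.

Lemma has_grad_chart y k : differentiable h y ->
  has_grad (fun y => chart y 0 k) y (fun i => jac y i k).
Proof.
move=> dh; rewrite (_ : (fun y => _) = fun y => moved y 0 (lshift 1 k)).
  apply: has_grad_eq (has_grad_moved _ dh) _ => i.
  rewrite /jac [LHS]mxE [RHS]mxE; apply: eq_bigr => l _.
  by rewrite [lsubmx Q _ _]mxE.
by apply/funext => z; rewrite mxE.
Qed.

Lemma differentiable_chart y : differentiable h y -> differentiable chart y.
Proof.
by move=> dh; apply: differentiable_row => k; have [] := has_grad_chart k dh.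
Qed.

Variable U : set 'rV[R]_n.
Hypothesis openU : open U.
Hypothesis dh : forall y, U y -> differentiable h y /\ differentiable (grad h) y.
Hypothesis dh' : forall y, U y ->
  differentiable h' (chart y) /\ differentiable (grad h') (chart y).
Hypothesis heightE : forall y, U y -> moved y 0 (rshift n 0) = h' (chart y).
Hypothesis QQ : Q *m Q^T = 1%:M.

Lemma nearU y : U y -> \forall z \near y, U z.
Proof. by move=> Uy; apply: open_nbhs_nbhs; split. Qed.

(** Differentiate the identity heightE. *)
Lemma tangent_transition y : U y ->
  tangent_basis (grad h y) *m rsubmx Q = jac y *m (grad h' (chart y))^T.
Proof.
move=> Uy; have [dhy _] := dh Uy; have [dhy' _] := dh' Uy.
have h1 := has_grad_moved (rshift n 0) dhy.
have g' : has_grad h' (chart y) (fun k => grad h' (chart y) 0 k).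
  by split=> // k; rewrite mxE.
have := has_grad_comp g' (fun k => has_grad_chart k dhy).
have : \near y, h' (chart y) = moved y 0 (rshift n 0).
  by near=> z; rewrite heightE //; near: z; exact: nearU.
move=> near_h /(has_grad_near near_h) [_ E2]; have [_ E1] := h1.
apply/matrixP => i j; rewrite [j]ord1.
transitivity (partial i (fun y => moved y 0 (rshift n 0)) y).
  rewrite E1 [LHS]mxE [RHS]mxE; apply: eq_bigr => l _.
  by rewrite [rsubmx Q _ _]mxE.
by rewrite E2 [RHS]mxE; apply: eq_bigr => k _; rewrite [_^T _ _]mxE.
Unshelve. all: by end_near. Qed.

(** Differentiate tangent_transition.  The second derivatives of the chart are
proportional to those of h, so they all collect on the left hand side, where
they make up the factor tilt. *)
Lemma hessian_transition y : U y ->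
  tilt y *: hessian h y = jac y *m hessian h' (chart y) *m (jac y)^T.
Proof.
move=> Uy; have [dhy dgy] := dh Uy; have [dhy' dgy'] := dh' Uy.
have tb i l : has_grad (fun y => tangent_basis (grad h y) i l) y
    (fun j => hessian h y j i * (l == rshift n 0)%:R).
  rewrite -[l]splitK; case: (fintype.split l) => k /=.
    under eq_fun do rewrite row_mxEl.
    apply: has_grad_eq (has_grad_cst _ y) _ => j.
    by rewrite eq_lrshift mulr0.
  rewrite [k]ord1; under eq_fun do rewrite row_mxEr mxE.
  by apply: has_grad_eq (has_grad_partial i dgy) _ => j; rewrite eqxx mulr1.
have tbM i p (M : 'M[R]_(n + 1, p)) k :
    has_grad (fun y => (tangent_basis (grad h y) *m M) i k) y
      (fun j => hessian h y j i * M (rshift n 0) k).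
  rewrite (_ : (fun y => _) =
    fun y => \sum_l M l k * tangent_basis (grad h y) i l); last first.
    apply/funext => z; rewrite mxE; apply: eq_bigr => l _; exact: mulrC.
  apply: has_grad_eq (has_grad_sum (fun l => has_gradZ _ (tb i l))) _ => j.
  rewrite (bigD1 (rshift n 0)) //= eqxx mulr1 mulrC big1 ?addr0 // => l.
  by move=> /negbTE ->; rewrite !mulr0.
apply/matrixP => j i.
have L := tbM i _ (rsubmx Q) 0.
have Rk k := has_gradM (tbM i _ (lsubmx Q) k)
  (has_grad_comp (has_grad_partial k dgy') (fun l => has_grad_chart l dhy)).
have := has_grad_sum Rk.
have near_eq : \near y,
    \sum_k (tangent_basis (grad h y) *m lsubmx Q) i k * grad h' (chart y) 0 k =
    (tangent_basis (grad h y) *m rsubmx Q) i 0.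
  near=> z; rewrite tangent_transition; last by near: z; exact: nearU.
  by rewrite [RHS]mxE; apply: eq_bigr => k _; rewrite [_^T _ _]mxE.
move=> /(has_grad_near near_eq) [_ E]; have [_ E'] := L.
move: (E j); rewrite E' big_split /= => {}E.
rewrite [LHS]mxE /tilt /upward_normal mxE big_split_ord big_ord1 /=.
rewrite !row_mxEr [1%:M 0 0]mxE eqxx mul1r [Q^T _ _]mxE.
transitivity (\sum_k (tangent_basis (grad h y) *m lsubmx Q) i k *
  (\sum_k0 jac y j k0 * hessian h' (chart y) k0 k)).
  (* The added terms are those with the second derivatives of the chart. *)
  apply/(addIr (\sum_k grad h' (chart y) 0 k *
    (hessian h y j i * lsubmx Q (rshift n 0) k))).
  rewrite -E [rsubmx Q _ _]mxE addrC mulrDl mulr_suml -addrA.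
  rewrite -big_split /= big1 ?addr0 1?[ord0]ord1 1?mulrC // => k _.
  by rewrite row_mxEl !mxE; ring.
rewrite [RHS]mxE; apply: eq_bigr => k _.
by rewrite [(jac y)^T _ _]mxE mulrC; congr (_ * _); rewrite [RHS]mxE.
Unshelve. all: by end_near. Qed.

(** By area_change: the normal of the first graph would otherwise vanish. *)
Lemma tilt_neq0 y : U y -> tilt y != 0.
Proof.
move=> Uy; have := area_change QQ (tangent_transition Uy).
rewrite -/(tilt y) => E; apply/eqP => t0; move: E.
by rewrite t0 expr0n /= mul0r => /eqP; rewrite lt_eqF // ltr_pwDl // dot_ge0.
Qed.

Lemma area_transition y : U y ->
  area_factor h' (chart y) = `|tilt y| * area_factor h y.
Proof.
move=> Uy; have := area_change QQ (tangent_transition Uy).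
rewrite -/(tilt y) -!area_factor_sqr -exprMn => E.
apply/eqP; rewrite -(@eqrXn2 _ 2) // ?(ltW (area_factor_gt0 _ _)) //.
  by rewrite -E !exprMn real_normK ?num_real.
by rewrite mulr_ge0 // ltW // area_factor_gt0.
Qed.

Lemma tangent_norm_transition y v : U y ->
  tangent_norm h' (chart y) (v *m jac y) = tangent_norm h y v.
Proof.
move=> Uy; rewrite /tangent_norm /dot /first_form; congr (Num.sqrt (_ 0 0)).
rewrite (first_form_change QQ (tangent_transition Uy)) -/(jac y).
by rewrite [(v *m jac y)^T]trmx_mul !mulmxA.
Qed.

Lemma dot_second_form (k : 'rV[R]_n -> R) y v w :
  dot (v *m second_form k y) w =
  (area_factor k y)^-1 * dot (v *m hessian k y) w.
Proof. by rewrite /dot /second_form -scalemxAr -scalemxAl mxE. Qed.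

Lemma dot_hessian_transition y v w : U y ->
  tilt y * dot (v *m hessian h y) w =
  dot (v *m jac y *m hessian h' (chart y)) (w *m jac y).
Proof.
move=> Uy; have /(congr1 (fun M : 'M[R]_n => dot (v *m M) w)) :=
  hessian_transition Uy.
rewrite /dot -scalemxAr -scalemxAl mxE => ->.
by rewrite [(w *m jac y)^T]trmx_mul !mulmxA.
Qed.

Lemma second_form_transition y v w : U y ->
  `|dot (v *m second_form h y) w| =
  `|dot (v *m jac y *m second_form h' (chart y)) (w *m jac y)|.
Proof.
have aux (a a' W W' D D' t : R) : a = W^-1 * D -> a' = W'^-1 * D' ->
    t * D = D' -> W' = `|t| * W -> t != 0 -> `|a| = `|a'|.
  move=> -> -> <- -> t0; rewrite !normrM !normfV normrM normr_id.
  by rewrite invfM mulrACA mulVf ?mul1r ?normr_eq0.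
by move=> Uy; apply: (aux _ _ _ _ _ _ _ (dot_second_form h y v w)
  (dot_second_form h' (chart y) (v *m jac y) (w *m jac y))
  (dot_hessian_transition v w Uy) (area_transition Uy) (tilt_neq0 Uy)).
Qed.

(** The quotient in front is the sign of tilt; written in this way it is visibly
continuous in y. *)
Lemma mean_curvature_transition y : U y ->
  mean_curvature h y = area_factor h' (chart y) / (tilt y * area_factor h y) *
    mean_curvature h' (chart y).
Proof.
have aux (a a' W W' T T' t : R) : a = W^-1 * T -> a' = W'^-1 * T' ->
    t * T = T' -> W' != 0 -> W != 0 -> t != 0 -> a = W' / (t * W) * a'.
  by move=> -> -> <- W'0 W0 t0; field; rewrite t0 W0 W'0.
move=> Uy; have [_ dgy] := dh Uy; have [_ dgy'] := dh' Uy.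
exact: (aux _ _ _ _ _ _ _ (mean_curvatureE dgy) (mean_curvatureE dgy')
  (trace_change QQ (tangent_transition Uy) (hessian_transition Uy))
  (lt0r_neq0 (area_factor_gt0 h' _)) (lt0r_neq0 (area_factor_gt0 h y))
  (tilt_neq0 Uy)).
Qed.

End Transition.

(** * Overlapping patches of one hypersurface *)

Section Patches.
Context {R : realType} {n : nat}.
Implicit Types (S : set 'rV[R]_(n + 1)) (P : @Defs.patch R n).

Definition patch_turn P P' : 'M[R]_(n + 1) := Defs.rot P *m (Defs.rot P')^T.
Definition patch_move P P' : 'rV[R]_(n + 1) :=
  (Defs.shift P - Defs.shift P') *m (Defs.rot P')^T.

Definition overlap P P' : set 'rV[R]_n :=
  [set y | dom P y /\ window P' (patch_point P y)].

Definition patch_chart P P' : 'rV[R]_n -> 'rV[R]_n :=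
  chart (height P) (patch_turn P P') (patch_move P P').

Variables (S : set 'rV[R]_(n + 1)) (P P' : @Defs.patch R n).
Hypothesis SP : twice_differentiable_patch S P.
Hypothesis SP' : twice_differentiable_patch S P'.

Lemma patch_turn_orthogonal : patch_turn P P' *m (patch_turn P P')^T = 1%:M.
Proof.
have [[rP _ _ _] _] := SP; have [[/mulmx1C rP' _ _ _] _] := SP'.
by rewrite /patch_turn trmx_mul trmxK mulmxA -(mulmxA (Defs.rot P)) rP' mulmx1.
Qed.

(** Both patches parametrize the same set inside both windows, so the moved point
lies on the graph over the second domain; its first coordinates are then forced. *)
Lemma overlap_moved y : overlap P P' y ->
  dom P' (patch_chart P P' y) /\
  moved (height P) (patch_turn P P') (patch_move P P') y =
  row_mx (patch_chart P P' y) (height P' (patch_chart P P' y))%:M.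
Proof.
have [[_ _ _ PE] _] := SP; have [[/mulmx1C rP' _ _ PE'] _] := SP'.
have rr : Defs.rot P' *m (Defs.rot P')^T = 1%:M by exact: mulmx1C.
move=> [Dy Wy].
have Sy : S (patch_point P y).
  have : (patch_point P @` dom P) (patch_point P y) by exists y.
  by rewrite -PE => -[].
have : (patch_point P' @` dom P') (patch_point P y) by rewrite -PE'.
move=> [y' Dy' E'].
have E : moved (height P) (patch_turn P P') (patch_move P P') y =
    row_mx y' (height P' y')%:M.
  have <- : (patch_point P' y' - Defs.shift P') *m (Defs.rot P')^T =
      row_mx y' (height P' y')%:M.
    by rewrite /patch_point addrK -mulmxA rr mulmx1.
  by rewrite E' /moved /patch_turn /patch_move mulmxA -mulmxDl addrA.
have c : patch_chart P P' y = y'.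
  by rewrite /patch_chart /chart E row_mxKl.
by rewrite c E.
Qed.

Lemma overlap_dh y : overlap P P' y ->
  differentiable (height P) y /\ differentiable (grad (height P)) y.
Proof. by have [_ tP] := SP; move=> [Dy _]; exact: tP. Qed.

Lemma overlap_dh' y : overlap P P' y ->
  differentiable (height P') (patch_chart P P' y) /\
  differentiable (grad (height P')) (patch_chart P P' y).
Proof.
by have [_ tP] := SP'; move=> /overlap_moved[Dy _]; exact: tP.
Qed.

Lemma overlap_height y : overlap P P' y ->
  moved (height P) (patch_turn P P') (patch_move P P') y 0 (rshift n 0) =
  height P' (patch_chart P P' y).
Proof. by move=> /overlap_moved[_ ->]; rewrite row_mxEr mxE eqxx. Qed.

Lemma continuous_patch_point y : dom P y -> {for y, continuous (patch_point P)}.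
Proof.
move=> Dy; have [_ tP] := SP; have [dh _] := tP _ Dy.
apply: differentiable_continuous; apply: differentiable_row => k.
by have [] := has_grad_moved (Defs.rot P) (Defs.shift P) k dh.
Qed.

Lemma open_overlap : open (overlap P P').
Proof.
have [[_ _ oD _] _] := SP; have [[_ oW _ _] _] := SP'.
rewrite openE => y [Dy Wy].
have n1 : \forall z \near y, dom P z by apply: open_nbhs_nbhs; split.
have n2 : \forall z \near y, window P' (patch_point P z).
  apply: (continuous_patch_point Dy); exact: open_nbhs_nbhs (conj oW Wy).
by rewrite /interior; near=> z; split; near: z.
Unshelve. all: by end_near. Qed.

Lemma continuous_chart y : overlap P P' y ->
  {for y, continuous (patch_chart P P')}.
Proof.
move=> /overlap_dh[dh _]; apply: differentiable_continuous.
exact: differentiable_chart.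
Qed.

Lemma continuous_grad_chart y : overlap P P' y ->
  {for y, continuous (fun z => grad (height P') (patch_chart P P' z))}.
Proof.
move=> Oy; have [_ dg'] := overlap_dh' Oy.
exact: continuous_comp (continuous_chart Oy) (differentiable_continuous dg').
Qed.

Let tiltP := tilt (height P) (height P') (patch_turn P P') (patch_move P P').
Let jacP := jac (height P) (patch_turn P P').

Lemma continuous_tilt y : overlap P P' y -> {for y, continuous tiltP}.
Proof.
move=> Oy; pose Q := patch_turn P P'.
rewrite (_ : tiltP = fun z => Q (rshift n 0) (rshift n 0) -
    \sum_k grad (height P') (patch_chart P P' z) 0 k * Q (rshift n 0) (lshift 1 k)).
  apply: continuousB; first exact: cst_continuous.
  apply: continuous_sum_at => k; apply: continuousM; last exact: cst_continuous.
  exact: continuous_comp (continuous_grad_chart Oy) (@coord_continuous _ _ _ 0 k _).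
apply/funext => z; rewrite /tiltP /tilt mxE big_split_ord big_ord1 /= addrC.
rewrite row_mxEr [1%:M _ _]mxE eqxx mul1r [Q^T _ _]mxE; congr (_ + _).
rewrite -sumrN; apply: eq_bigr => k _; rewrite row_mxEl [Q^T _ _]mxE.
by rewrite [X in X * _]mxE mulNr.
Qed.

Lemma continuous_jac y : overlap P P' y -> {for y, continuous jacP}.
Proof.
move=> Oy; have [_ dg] := overlap_dh Oy.
apply: continuous_mulmx; last exact: cst_continuous.
apply: continuous_mx => i j; rewrite -[j]splitK; case: (fintype.split j) => k /=.
  rewrite (_ : (fun z => _) = cst (1%:M i k)); first exact: cst_continuous.
  by apply/funext => z; rewrite row_mxEl.
rewrite (_ : (fun z => _) = fun z => grad (height P) z 0 i).
  exact: continuous_comp (differentiable_continuous dg) (@coord_continuous _ _ _ 0 i _).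
by apply/funext => z; rewrite row_mxEr mxE [k]ord1.
Qed.

Lemma mean_curvature_overlap y : overlap P P' y ->
  {for patch_chart P P' y, continuous (mean_curvature (height P'))} ->
  {for y, continuous (mean_curvature (height P))}.
Proof.
move=> Oy cH.
have [_ dg] := overlap_dh Oy; have [_ dg'] := overlap_dh' Oy.
have [dW _] := has_grad_area dg; have [dW' _] := has_grad_area dg'.
have near_eq : \near y, area_factor (height P') (patch_chart P P' y) /
      (tiltP y * area_factor (height P) y) *
      mean_curvature (height P') (patch_chart P P' y) =
    mean_curvature (height P) y.
  near=> z; apply/esym; apply: (mean_curvature_transition open_overlap overlap_dh
    overlap_dh' overlap_height patch_turn_orthogonal).
  by near: z; apply: open_nbhs_nbhs; split; [exact: open_overlap|].
apply: near_eq_continuous near_eq _.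
apply: continuousM; last exact: continuous_comp (continuous_chart Oy) cH.
apply: continuousM.
  exact: continuous_comp (continuous_chart Oy) (differentiable_continuous dW').
apply: continuousV.
  rewrite mulf_neq0 ?(lt0r_neq0 (area_factor_gt0 _ _)) //.
  exact: (tilt_neq0 open_overlap overlap_dh overlap_dh' overlap_height
    patch_turn_orthogonal).
by apply: continuousM; [exact: continuous_tilt|exact: differentiable_continuous].
Unshelve. all: by end_near. Qed.

(** The transformation law can be solved for the Hessian of the first height, with
coefficients that depend only on first derivatives. *)
Lemma hessian_overlap y : overlap P P' y ->
  {for patch_chart P P' y, continuous (hessian (height P'))} ->
  {for y, continuous (hessian (height P))}.
Proof.
move=> Oy cH.
have tilt0 z : overlap P P' z -> tiltP z != 0.
  exact: (tilt_neq0 open_overlap overlap_dh overlap_dh' overlap_height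
    patch_turn_orthogonal).
have near_eq : \near y, (tiltP y)^-1 *: (jacP y *m
      hessian (height P') (patch_chart P P' y) *m (jacP y)^T) =
    hessian (height P) y.
  near=> z; have Oz : overlap P P' z.
    by near: z; apply: open_nbhs_nbhs; split; [exact: open_overlap|].
  have E := hessian_transition open_overlap overlap_dh overlap_dh' overlap_height Oz.
  apply: etrans (congr1 ( *:%R (tiltP z)^-1) (esym E)) _.
  by rewrite scalerA mulVf ?scale1r ?tilt0.
apply: near_eq_continuous near_eq _.
have cV : {for y, continuous (fun y => (tiltP y)^-1)}.
  by apply: continuousV; [exact: tilt0|exact: continuous_tilt].
have cJ := continuous_jac Oy.
have cC : {for y, continuous (fun y => hessian (height P') (patch_chart P P' y))}.
  exact: continuous_comp (continuous_chart Oy) cH.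
exact: (cvgZ cV (continuous_mulmx (continuous_mulmx cJ cC) (continuous_trmx cJ))).
Unshelve. all: by end_near. Qed.

End Patches.

Section Graph.
Context {R : realType} {n : nat}.
Variable u : 'rV[R]_n -> R.
Hypothesis du : twice_differentiable_on setT u.

Definition graph_patch : @Defs.patch R n := Patch 1%:M 0 setT setT u.
Definition graph_of : set 'rV[R]_(n + 1) := patch_point graph_patch @` setT.

Lemma graph_patchP : twice_differentiable_patch graph_of graph_patch.
Proof.
split=> //; split; rewrite ?trmx1 ?mulmx1 //; try exact: openT.
by rewrite setIT.
Qed.

Lemma graph_twice_differentiable : twice_differentiable_hypersurface graph_of.
Proof. by move=> p _; exists graph_patch => //; exact: graph_patchP. Qed.

Lemma graph_mean_curvature : continuous (mean_curvature u) ->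
  continuous_mean_curvature graph_of.
Proof.
move=> cH P SP x Dx.
by apply: (mean_curvature_overlap SP graph_patchP) => //; exact: cH.
Qed.

Lemma graph_bounded C :
  (forall x v w, `|dot (v *m second_form u x) w| <=
     C * tangent_norm u x v * tangent_norm u x w) ->
  bounded_second_form graph_of.
Proof.
move=> bu; exists C => P SP x Dx v w.
have Ox : overlap P graph_patch x by split.
have oO := open_overlap SP graph_patchP.
have d1 y (Oy : overlap P graph_patch y) := overlap_dh SP Oy.
have d2 := overlap_dh' SP graph_patchP.
have h2 := overlap_height SP graph_patchP.
have oQ := patch_turn_orthogonal SP graph_patchP.
have E := second_form_transition oO d1 d2 h2 oQ v w Ox.
have Tv z := (tangent_norm_transition oO d1 d2 h2 oQ z Ox).
have aux (a b s t s' t' : R) : a = b -> b <= C * s * t ->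
  s = s' -> t = t' -> a <= C * s' * t' by move=> -> + <- <-.
exact: aux E (bu _ _ _) (Tv v) (Tv w).
Qed.

(** The patch may be tilted; hessian_overlap goes from the graph itself to it. *)
Lemma graph_not_C2 x : ~ {for x, continuous (hessian u)} ->
  ~ C2_hypersurface graph_of.
Proof.
move=> ncH C2; have Sx : graph_of (patch_point graph_patch x) by exists x.
have [P [PS [tP cP] Wx]] := C2 _ Sx; apply: ncH.
have SP : twice_differentiable_patch graph_of P by [].
have Ox : overlap graph_patch P x by split.
apply: (hessian_overlap graph_patchP SP Ox); apply: cP.
by have [] := overlap_moved graph_patchP SP Ox.
Qed.

End Graph.

(** * A bump with small Laplacian and unit mixed derivative *)

Section PositivePart.
Context {R : realType}.

(** Powers of the positive part: ppow 3 is C^2, so it cuts off without losing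
second derivatives. *)
Definition ppow m (t : R) : R := Num.max t 0 ^+ m.

Lemma ppow_le1 m t : t <= 1 -> 0 <= ppow m t <= 1.
Proof.
move=> t1; have m0 : 0 <= Num.max t 0 by rewrite le_max lexx orbT.
by rewrite exprn_ge0 //= exprn_ile1 // ge_max t1 ler01.
Qed.

Lemma ppow_le0 m t : t <= 0 -> ppow m.+1 t = 0.
Proof. by move=> t0; rewrite /ppow max_r // expr0n. Qed.

Lemma continuous_ppow m : continuous (ppow m).
Proof.
move=> t; apply: (@continuous_comp _ _ _ (fun t : R => Num.max t 0) (fun x => x ^+ m)).
  by apply: continuous_max; [exact: cvg_id|exact: cvg_cst].
exact: exprn_continuous.
Qed.

(** At 0 the difference quotient of ppow m.+2 is ppow m.+1, which is continuous and
vanishes there. *)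
Lemma is_derive_ppow m (t : R) :
  is_derive t 1 (ppow m.+2) (m.+2%:R * ppow m.+1 t).
Proof.
have [t0|t0|->] := ltgtP t 0.
- rewrite ppow_le0 ?ltW // mulr0.
  apply: (near_eq_is_derive (f := cst 0)).
  near=> z; rewrite ppow_le0 // ltW //; near: z; exact: lt_nbhsl.
- have dpow : is_derive t 1 (fun x : R => x ^+ m.+2) (m.+2%:R * t ^+ m.+1).
    by split; [exact: exprn_derivable|rewrite exp_derive scaler1 -[_ *: _]/(_ * _)].
  rewrite {2}/ppow max_l ?ltW //; apply: near_eq_is_derive dpow.
  near=> z; rewrite /ppow max_l // ltW //; near: z; exact: lt_nbhsr.
- rewrite ppow_le0 // mulr0.
  have c : h^-1 *: ((ppow m.+2 \o shift 0) (h *: 1) - ppow m.+2 0)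
      @[h --> 0^'] --> (0 : R).
    have := @continuous_ppow m.+1 0; rewrite /continuous_at ppow_le0 // => c0.
    apply: cvg_trans (cvg_within_filter _ c0); apply: near_eq_cvg.
    near=> h; have h0 : h != 0 by near: h; exact: nbhs_dnbhs_neq.
    have -> : ppow m.+2 (0 : R) = 0 by rewrite ppow_le0.
    rewrite /= subr0 addr0 scaler1.
    have [hp|hn] := ltP 0 h.
      rewrite /ppow max_l ?ltW //.
      by rewrite -[RHS]/(h^-1 * h ^+ m.+2) (exprS h m.+1) mulKf.
    by rewrite !ppow_le0 // scaler0.
  apply: DeriveDef; first by apply/cvg_ex; exists 0.
  exact: cvg_lim c.
Unshelve. all: by end_near. Qed.

End PositivePart.

(** The bump is centred at the point where the coordinates i0 and i1 are a and 0.
The number d regularizes the logarithm at the centre. *)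
Section Bump.
Context {R : realType} {n : nat}.
Variables (i0 i1 : 'I_n) (a d : R).
Hypothesis i01 : i0 != i1.
Hypothesis a0 : 0 < a.
Hypothesis a1 : a <= 1.
Hypothesis d0 : 0 < d.
Implicit Types (x : 'rV[R]_n) (i j : 'I_n).

Definition off0 x : R := x 0 i0 - a.
Definition off1 x : R := x 0 i1.
Definition sqd x : R := off0 x ^+ 2 + off1 x ^+ 2.
(** The estimates rest on the products of two coordinates of the offset times isqd
being at most 1 in absolute value. *)
Definition isqd x : R := (d + sqd x)^-1.
(** It decreases from 1 at the centre and is negative once sqd exceeds d * expR a^-1;
its derivatives carry a factor a. *)
Definition logt x : R := 1 - a * ln (1 + sqd x / d).
Definition bump x : R := off0 x * off1 x * ppow 3 (logt x).

Definition doff0 i : R := (i0 == i)%:R.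
Definition doff1 i : R := (i1 == i)%:R.
(** Half the partial of sqd, and below it the partial of off0 * off1. *)
Definition hdsq x i : R := off0 x * doff0 i + off1 x * doff1 i.
Definition dprod x i : R := off0 x * doff1 i + off1 x * doff0 i.

Definition bump_grad x j : R := dprod x j * ppow 3 (logt x) -
  6 * a * (off0 x * off1 x * isqd x * hdsq x j) * ppow 2 (logt x).

(** The terms of the Hessian in which a derivative falls on the cutoff. *)
Definition bump_error x i j : R :=
  12 * a * (off0 x * off1 x * isqd x * (hdsq x i * hdsq x j * isqd x)) *
    ppow 2 (logt x)
  + 24 * a ^+ 2 * (off0 x * off1 x * isqd x * (hdsq x i * hdsq x j * isqd x)) *
    ppow 1 (logt x)
  - 6 * a * (dprod x j * hdsq x i * isqd x + dprod x i * hdsq x j * isqd x) *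
    ppow 2 (logt x)
  - 6 * a * (off0 x * off1 x * isqd x * (doff0 i * doff0 j + doff1 i * doff1 j)) *
    ppow 2 (logt x).

Definition bump_hess x i j : R :=
  (doff0 i * doff1 j + doff1 i * doff0 j) * ppow 3 (logt x) + bump_error x i j.

Lemma sqd_ge0 x : 0 <= sqd x.
Proof. by rewrite addr_ge0 // sqr_ge0. Qed.

Lemma sqd_den_gt0 x : 0 < d + sqd x.
Proof. by rewrite ltr_pwDl // sqd_ge0. Qed.

Lemma isqd_gt0 x : 0 < isqd x.
Proof. by rewrite invr_gt0 sqd_den_gt0. Qed.

Lemma has_grad_off0 x : has_grad off0 x doff0.
Proof.
apply: has_grad_eq (has_gradB (has_grad_coord i0 x) (has_grad_cst a x)) _ => i.
by rewrite subr0.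
Qed.

Lemma has_grad_off1 x : has_grad off1 x doff1.
Proof. exact: has_grad_coord. Qed.

Lemma has_grad_sqd x : has_grad sqd x (fun i => 2 * hdsq x i).
Proof.
apply: has_grad_eq (has_gradD (has_gradM (has_grad_off0 x) (has_grad_off0 x))
  (has_gradM (has_grad_off1 x) (has_grad_off1 x))) _ => i.
rewrite /hdsq; ring.
Qed.

Lemma has_grad_isqd x : has_grad isqd x (fun i => - 2 * isqd x ^+ 2 * hdsq x i).
Proof.
have h := has_gradD (has_grad_cst d x) (has_grad_sqd x).
apply: has_grad_eq (has_gradV (lt0r_neq0 (sqd_den_gt0 x)) h) _ => i.
rewrite /isqd; field; exact: lt0r_neq0 (sqd_den_gt0 x).
Qed.

Lemma has_grad_logt x : has_grad logt x (fun i => - 2 * a * isqd x * hdsq x i).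
Proof.
have p0 : 0 < 1 + sqd x / d.
  by rewrite ltr_pwDl // divr_ge0 ?sqd_ge0 ?ltW.
have h := has_gradD (has_grad_cst 1 x)
  (has_gradM (has_grad_sqd x) (has_grad_cst d^-1 x)).
apply: has_grad_eq (has_gradB (has_grad_cst 1 x)
  (has_gradZ a (has_grad_comp1 h (is_derive1_ln p0)))) _ => i.
rewrite /isqd; have := lt0r_neq0 (sqd_den_gt0 x); have := lt0r_neq0 d0 => d0' e0.
by field; rewrite e0 d0'.
Qed.

Lemma has_grad_ppow m x : has_grad (fun y => ppow m.+2 (logt y)) x
  (fun i => m.+2%:R * ppow m.+1 (logt x) * (- 2 * a * isqd x * hdsq x i)).
Proof. exact: has_grad_comp1 (has_grad_logt x) (is_derive_ppow m (logt x)). Qed.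

Lemma has_grad_bump x : has_grad bump x (bump_grad x).
Proof.
apply: has_grad_eq (has_gradM (has_gradM (has_grad_off0 x) (has_grad_off1 x))
  (has_grad_ppow 1 x)) _ => i.
rewrite /bump_grad /dprod /hdsq; ring.
Qed.

Lemma has_grad_dprod x j :
  has_grad (dprod ^~ j) x (fun i => doff0 i * doff1 j + doff1 i * doff0 j).
Proof.
apply: has_grad_eq (has_gradD (has_gradM (has_grad_off0 x) (has_grad_cst _ x))
  (has_gradM (has_grad_off1 x) (has_grad_cst _ x))) _ => i.
ring.
Qed.

Lemma has_grad_hdsq x j :
  has_grad (hdsq ^~ j) x (fun i => doff0 i * doff0 j + doff1 i * doff1 j).
Proof.
apply: has_grad_eq (has_gradD (has_gradM (has_grad_off0 x) (has_grad_cst _ x))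
  (has_gradM (has_grad_off1 x) (has_grad_cst _ x))) _ => i.
ring.
Qed.

Lemma has_grad_bump_grad x j :
  has_grad (bump_grad ^~ j) x (fun i => bump_hess x i j).
Proof.
apply: has_grad_eq (has_gradB (has_gradM (has_grad_dprod x j) (has_grad_ppow 1 x))
  (has_gradM (has_gradZ (6 * a) (has_gradM (has_gradM (has_gradM (has_grad_off0 x)
    (has_grad_off1 x)) (has_grad_isqd x)) (has_grad_hdsq x j))) (has_grad_ppow 0 x))) _.
move=> i; rewrite /bump_hess /bump_error /dprod /hdsq; ring.
Qed.

Lemma continuous_bump_hess i j : continuous (fun x => bump_hess x i j).
Proof.
move=> x.
have gc (f : 'rV[R]_n -> R) g : has_grad f x g -> {for x, continuous f}.
  by move=> [df _]; exact: differentiable_continuous.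
have cX := gc _ _ (has_grad_off0 x); have cY := gc _ _ (has_grad_off1 x).
have cS := gc _ _ (has_grad_isqd x).
have cM k := gc _ _ (has_grad_hdsq x k); have cN k := gc _ _ (has_grad_dprod x k).
have cP m : {for x, continuous (fun y => ppow m (logt y))}.
  exact: continuous_comp (gc _ _ (has_grad_logt x)) (@continuous_ppow _ m _).
have cc (c : R) : {for x, continuous (fun=> c)} by exact: cst_continuous.
have cB (f g : 'rV[R]_n -> R) : {for x, continuous f} -> {for x, continuous g} ->
  {for x, continuous (fun y => f y - g y)} by exact: continuousB.
have cD (f g : 'rV[R]_n -> R) : {for x, continuous f} -> {for x, continuous g} ->
  {for x, continuous (fun y => f y + g y)} by exact: continuousD.
have cMl (f g : 'rV[R]_n -> R) : {for x, continuous f} -> {for x, continuous g} ->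
  {for x, continuous (fun y => f y * g y)} by exact: continuousM.
have cXYS := cMl _ _ (cMl _ _ cX cY) cS.
have cMMS := cMl _ _ (cMl _ _ (cM i) (cM j)) cS.
have cNMS k l := cMl _ _ (cMl _ _ (cN k) (cM l)) cS.
have e0 := cMl _ _ (cc (doff0 i * doff1 j + doff1 i * doff0 j)) (cP 3).
have e1 := cMl _ _ (cMl _ _ (cc (12 * a)) (cMl _ _ cXYS cMMS)) (cP 2).
have e2 := cMl _ _ (cMl _ _ (cc (24 * a ^+ 2)) (cMl _ _ cXYS cMMS)) (cP 1).
have e3 := cMl _ _ (cMl _ _ (cc (6 * a)) (cD _ _ (cNMS j i) (cNMS i j))) (cP 2).
have e4 := cMl _ _ (cMl _ _ (cc (6 * a))
  (cMl _ _ cXYS (cc (doff0 i * doff0 j + doff1 i * doff1 j)))) (cP 2).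
exact: cD _ _ e0 (cB _ _ (cB _ _ (cD _ _ e1 e2) e3) e4).
Qed.

Lemma doff_cases i : [\/ doff0 i = 1 /\ doff1 i = 0, doff0 i = 0 /\ doff1 i = 1 |
  doff0 i = 0 /\ doff1 i = 0].
Proof.
rewrite /doff0 /doff1; have [<-|_] := eqVneq i0 i.
  by rewrite eq_sym (negbTE i01); constructor 1.
by case: eqP => _; [constructor 2|constructor 3].
Qed.

Lemma hdsq_dprod_sqr_le x i : [/\ hdsq x i ^+ 2 <= sqd x & dprod x i ^+ 2 <= sqd x].
Proof.
rewrite /hdsq /dprod /sqd; have := sqr_ge0 (off0 x); have := sqr_ge0 (off1 x).
by case: (doff_cases i) => -[-> ->]; rewrite !(mulr0, mulr1, addr0, add0r, expr0n) /=;
  split; lra.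
Qed.

Lemma norm_mul_isqd_le1 x (y z : R) : y ^+ 2 <= sqd x -> z ^+ 2 <= sqd x ->
  `|y * z * isqd x| <= 1.
Proof.
move=> hy hz; have S0 := isqd_gt0 x.
rewrite normrM (gtr0_norm S0) ler_pdivrMr ?sqd_den_gt0 // mul1r.
suff : `|y * z| <= sqd x by move/le_trans; apply; rewrite lerDr ltW.
rewrite ler_norml; have := sqr_ge0 (y + z); have := sqr_ge0 (y - z).
nra.
Qed.

Lemma logt_le1 x : logt x <= 1.
Proof.
rewrite /logt lerBlDr lerDl mulr_ge0 //; first exact: ltW.
by rewrite ln_ge0 // lerDl divr_ge0 ?sqd_ge0 // ltW.
Qed.

Lemma norm_off_isqd_le1 x : `|off0 x * off1 x * isqd x| <= 1.
Proof. by apply: norm_mul_isqd_le1; rewrite /sqd ?lerDl ?lerDr sqr_ge0. Qed.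

(** Every term is a multiple of a, or of a^2 <= a, times quantities of absolute
value at most 1. *)
Lemma norm_bump_error x i j : `|bump_error x i j| <= 100 * a.
Proof.
have [Mi Ni] := hdsq_dprod_sqr_le x i; have [Mj Nj] := hdsq_dprod_sqr_le x j.
have h1 := norm_off_isqd_le1 x; have h2 := norm_mul_isqd_le1 Mi Mj.
have h3 := norm_mul_isqd_le1 Nj Mi; have h4 := norm_mul_isqd_le1 Ni Mj.
have p1 := ppow_le1 1 (logt_le1 x); have p2 := ppow_le1 2 (logt_le1 x).
have h5 : `|doff0 i * doff0 j + doff1 i * doff1 j| <= 1.
  by case: (doff_cases i) => -[-> ->]; case: (doff_cases j) => -[-> ->];
    rewrite !(mulr0, mulr1, addr0, add0r) ?normr1 ?normr0 ?ler01.
have small (c u v : R) : 0 <= c -> `|u| <= 1 -> 0 <= v <= 1 -> `|c * u * v| <= c.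
  move=> c0 hu /andP[v0 v1]; rewrite !normrM (ger0_norm c0) (ger0_norm v0).
  rewrite -mulrA ler_piMr // mulr_ile1 //.
have mul1 (u v : R) : `|u| <= 1 -> `|v| <= 1 -> `|u * v| <= 1.
  by move=> hu hv; rewrite normrM mulr_ile1.
have aa : a ^+ 2 <= a by rewrite expr2 ler_piMr // ltW.
have a0' := ltW a0.
apply: le_trans (ler_normB _ _) _.
apply: (@le_trans _ _ (94 * a + 6 * a)); last by lra.
apply: lerD; last first.
  by apply: small => //; [exact: mulr_ge0|exact: mul1].
apply: le_trans (ler_normB _ _) _.
apply: (@le_trans _ _ (82 * a + 12 * a)); last by lra.
apply: lerD; last first.
  rewrite mulrDr mulrDl; apply: le_trans (ler_normD _ _) _.
  apply: (@le_trans _ _ (6 * a + 6 * a)); last by lra.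
  by apply: lerD; apply: small => //; exact: mulr_ge0.
apply: le_trans (ler_normD _ _) _.
apply: (@le_trans _ _ (12 * a + 24 * a ^+ 2)); last by lra.
by apply: lerD; apply: small => //; rewrite ?mulr_ge0 ?sqr_ge0 //; exact: mul1.
Qed.

(** Where the cutoff does not vanish, sqd is below d * expR a^-1. *)
Lemma logt_gt0_off_lt x (r : R) : 0 <= r -> d * expR a^-1 <= r ^+ 2 -> 0 < logt x ->
  `|off0 x| < r /\ `|off1 x| < r.
Proof.
move=> r0 dr T0.
have rho : sqd x < r ^+ 2.
  apply: lt_le_trans dr.
  have : ln (1 + sqd x / d) < a^-1.
    rewrite -[a^-1]mul1r ltr_pdivlMr // mulrC; move: T0; rewrite /logt; lra.
  rewrite -ltr_expR lnK ?posrE; last by rewrite ltr_pwDl // divr_ge0 ?sqd_ge0 ?ltW.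
  move=> h; have : sqd x / d < expR a^-1 by lra.
  by rewrite ltr_pdivrMr // mulrC.
split; rewrite -(@ltr_pXn2r _ 2) ?nnegrE // real_normK ?num_real //;
  apply: le_lt_trans rho; by rewrite /sqd ?lerDl ?lerDr sqr_ge0.
Qed.

Lemma norm_dprod_le x j (r : R) :
  `|off0 x| <= r -> `|off1 x| <= r -> `|dprod x j| <= r.
Proof.
move=> hX hY; rewrite /dprod; have r0 := le_trans (normr_ge0 _) hX.
by case: (doff_cases j) => -[-> ->]; rewrite !(mulr0, mulr1, addr0, add0r) ?normr0.
Qed.

Lemma norm_hdsq_le x j (r : R) :
  `|off0 x| <= r -> `|off1 x| <= r -> `|hdsq x j| <= r.
Proof.
move=> hX hY; rewrite /hdsq; have r0 := le_trans (normr_ge0 _) hX.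
by case: (doff_cases j) => -[-> ->]; rewrite !(mulr0, mulr1, addr0, add0r) ?normr0.
Qed.

Lemma norm_bump x (r : R) : 0 <= r -> d * expR a^-1 <= r ^+ 2 -> `|bump x| <= r ^+ 2.
Proof.
move=> r0 dr; rewrite /bump.
have [/ppow_le0 ->|T0] := leP (logt x) 0; first by rewrite mulr0 normr0 sqr_ge0.
have [/ltW hX /ltW hY] := logt_gt0_off_lt r0 dr T0.
have /andP[p p'] := ppow_le1 3 (logt_le1 x).
rewrite normrM (ger0_norm p) -[r ^+ 2]mulr1 ler_pM // normrM expr2 ler_pM //.
Qed.

Lemma norm_bump_grad x j (r : R) : 0 <= r -> d * expR a^-1 <= r ^+ 2 ->
  `|bump_grad x j| <= 7 * r.
Proof.
move=> r0 dr; rewrite /bump_grad.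
have [T0|T0] := leP (logt x) 0.
  by rewrite !ppow_le0 // !mulr0 subr0 normr0 mulr_ge0.
have [/ltW hX /ltW hY] := logt_gt0_off_lt r0 dr T0.
have /andP[p p'] := ppow_le1 3 (logt_le1 x).
have /andP[q q'] := ppow_le1 2 (logt_le1 x).
have hN := norm_dprod_le j hX hY; have hM := norm_hdsq_le j hX hY.
apply: le_trans (ler_normB _ _) _.
apply: (@le_trans _ _ (r + 6 * r)); last by lra.
apply: lerD; first by rewrite normrM (ger0_norm p) -[r]mulr1 ler_pM.
have hz : `|off0 x * off1 x * isqd x * hdsq x j| <= r.
  by rewrite normrM -[r]mul1r ler_pM // norm_off_isqd_le1.
have a6 : 0 <= 6 * a by rewrite mulr_ge0 // ltW.
rewrite 2!normrM (ger0_norm a6) (ger0_norm q).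
apply: (@le_trans _ _ (6 * a * `|off0 x * off1 x * isqd x * hdsq x j|)).
  by rewrite ler_piMr // mulr_ge0.
by rewrite ler_pM // ler_piMr.
Qed.

Lemma norm_bump_hess x i j : `|bump_hess x i j| <= 101.
Proof.
have h := norm_bump_error x i j.
have /andP[p p'] := ppow_le1 3 (logt_le1 x).
have h5 : `|doff0 i * doff1 j + doff1 i * doff0 j| <= 1.
  by case: (doff_cases i) => -[-> ->]; case: (doff_cases j) => -[-> ->];
    rewrite !(mulr0, mulr1, addr0, add0r) ?normr1 ?normr0 ?ler01.
apply: le_trans (ler_normD _ _) _.
have : `|(doff0 i * doff1 j + doff1 i * doff0 j) * ppow 3 (logt x)| <= 1.
  by rewrite normrM (ger0_norm p) mulr_ile1.
by move=> h6; apply: le_trans (lerD h6 h) _; have := a1; lra.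
Qed.

(** The main term of the Hessian is off-diagonal, as i0 and i1 differ. *)
Lemma norm_bump_trace x : `|\sum_i bump_hess x i i| <= n%:R * (100 * a).
Proof.
apply: le_trans (ler_norm_sum _ _ _) _.
apply: (@le_trans _ _ (\sum_(i < n) 100 * a)); last first.
  by rewrite sumr_const card_ord [leRHS]mulr_natl.
apply: ler_sum => i _; rewrite /bump_hess.
have -> : doff0 i * doff1 i + doff1 i * doff0 i = 0.
  by case: (doff_cases i) => -[-> ->]; rewrite !(mulr0, mul0r, addr0).
by rewrite mul0r add0r norm_bump_error.
Qed.

Lemma bump_hess_center x : x 0 i0 = a -> x 0 i1 = 0 -> bump_hess x i0 i1 = 1.
Proof.
move=> x0 x1.
have X : off0 x = 0 by rewrite /off0 x0 subrr.
have Y : off1 x = 0 by [].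
have N k : dprod x k = 0 by rewrite /dprod X Y !mul0r addr0.
have T : logt x = 1.
  by rewrite /logt /sqd X Y !expr0n /= addr0 mul0r addr0 ln1 mulr0 subr0.
rewrite /bump_hess /bump_error T X !N !(mul0r, mulr0, addr0, subr0).
rewrite /ppow max_l // expr1n mulr1 /doff0 /doff1 !eqxx.
by rewrite (negbTE i01) mulr0 addr0 mulr1.
Qed.

End Bump.

(** * Bumps accumulating at a hyperplane *)

Section Assembly.
Context {R : realType} {n : nat}.
Variables (i0 i1 : 'I_n).
Hypothesis i01 : i0 != i1.
Implicit Types (x p : 'rV[R]_n) (a b t : R).

Definition scale a : Prop := exists k : nat, a = 2^-1 ^+ k.

(** It makes the support radius of the bump at most a^2 / 4 (core_expR), so that the
height and its gradient are O(a^2), with a comparable to the distance to the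
hyperplane. *)
Definition core a : R := (a ^+ 2 / 4) ^+ 2 * expR (- a^-1).

Definition bump_at a : 'rV[R]_n -> R := bump i0 i1 a (core a).

Definition active t : set R := [set a | scale a /\ `|t - a| < a / 4].

(** At most one bump is active at any point; where none is, the default scale 1 gives
the value 0, since then the bump of scale 1 is itself inactive. *)
Definition height_fun x : R := bump_at (xget 1 (active (x 0 i0))) x.

Lemma scale_itv a : scale a -> 0 < a <= 1.
Proof.
by move=> [k ->]; rewrite exprn_gt0 //= exprn_ile1 // invf_le1 ?ler1n.
Qed.

(** The intervals (2a/3, 4a/3) for distinct powers a of 1/2 are disjoint. *)
Lemma scale_unique a b t : scale a -> scale b ->
  `|t - a| < a / 3 -> `|t - b| < b / 3 -> a = b.
Proof.
wlog : a b / b <= a.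
  move=> W sa sb ta tb; have [ba|/ltW ab] := leP b a; first exact: W.
  by apply/esym; exact: W.
move=> ba sa sb; have /andP[a0 _] := scale_itv sa.
move: sa sb ba a0 => [k ->] [l ->] ba a0.
have [kl|lk] := ltnP k l; last first.
  by move=> _ _; apply/le_anti; rewrite ba andbT ler_wiXn2l // invf_le1 ?ler1n.
have : 2^-1 ^+ l <= 2^-1 ^+ k.+1 :> R.
  by rewrite ler_wiXn2l // invf_le1 ?ler1n.
rewrite exprS => h; rewrite !ltr_norml => /andP[h1 h2] /andP[h3 h4].
exfalso; move: (2^-1 ^+ k) (2^-1 ^+ l) h a0 h1 h2 h3 h4 => u v; lra.
Qed.

Lemma core_gt0 a : 0 < a -> 0 < core a.
Proof.
by move=> a0; rewrite mulr_gt0 ?expR_gt0 // exprn_gt0 // divr_gt0 ?exprn_gt0.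
Qed.

Lemma core_expR a : core a * expR a^-1 <= (a ^+ 2 / 4) ^+ 2.
Proof. by rewrite /core -mulrA -expRD addNr expR0 mulr1. Qed.

Lemma radius_ge0 a : 0 <= a ^+ 2 / 4.
Proof. by rewrite mulr_ge0 // sqr_ge0. Qed.

Lemma radius_le a : 0 < a <= 1 -> a ^+ 2 / 4 <= a / 4.
Proof.
by move=> /andP[a0 a1]; rewrite ler_pM2r // expr2 ler_piMr // ltW.
Qed.

Lemma bump_at_off a x : 0 < a <= 1 -> a / 4 <= `|x 0 i0 - a| -> bump_at a x = 0.
Proof.
move=> a01 xa; have /andP[a0 a1] := a01.
rewrite /bump_at /bump.
have [/ppow_le0 ->|T0] := leP (logt i0 i1 a (core a) x) 0; first by rewrite mulr0.
have [hX _] := logt_gt0_off_lt a0 (core_gt0 a0) (radius_ge0 a) (core_expR a) T0.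
have := lt_le_trans hX (radius_le a01); rewrite /off0; lra.
Qed.

Lemma height_active a x : scale a -> `|x 0 i0 - a| < a / 3 ->
  height_fun x = bump_at a x.
Proof.
move=> sa xa; rewrite /height_fun; case: xgetP => [b _ [sb xb]|none].
  have xb3 : `|x 0 i0 - b| < b / 3.
    by apply: lt_trans xb _; have /andP[b0 _] := scale_itv sb; lra.
  by rewrite (scale_unique sb sa xb3 xa).
have s1 : scale 1 by exists 0%N; rewrite expr0.
rewrite !bump_at_off ?scale_itv //.
  by rewrite leNgt; apply/negP => h; apply: (none a).
by rewrite leNgt; apply/negP => h; apply: (none 1).
Qed.

Lemma height_inactive x : (forall a, scale a -> a / 4 <= `|x 0 i0 - a|) ->
  height_fun x = 0.
Proof.
move=> na; rewrite /height_fun; case: xgetP => [b _ [sb xb]|none].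
  by have := na _ sb; rewrite leNgt xb.
have s1 : scale 1 by exists 0%N; rewrite expr0.
by rewrite bump_at_off ?scale_itv //; exact: na.
Qed.

Lemma near_coord p (e : R) :
  0 < e -> \forall x \near p, `|(x : 'rV[R]_n) 0 i0 - p 0 i0| < e.
Proof.
move=> e0; have /cvgrPdist_lt := @coord_continuous _ _ _ 0 i0 p.
by move=> /(_ e e0); apply: filterS => x; rewrite distrC.
Qed.

(** Bumps live in |x_0 - a| < a/4.  If p_0 is within a/3 of some scale a, so are the
nearby points, and no other bump can be active there.  Otherwise an active bump
near p would have a scale comparable to the distance moved, which is too small
compared with p_0. *)
Lemma height_local p : p 0 i0 != 0 ->
  (\forall x \near p, height_fun x = 0) \/
  exists a, [/\ scale a, a <= 2 * `|p 0 i0| &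
    \forall x \near p, height_fun x = bump_at a x].
Proof.
move=> p0; have [[a [sa pa]]|none] :=
  pselect (exists a, scale a /\ `|p 0 i0 - a| < a / 3).
  right; exists a; split=> //.
    have /andP[a0 _] := scale_itv sa; move: pa; rewrite ltr_norml => /andP[h1 h2].
    by have := ler_norm (p 0 i0); lra.
  have e0 : 0 < a / 3 - `|p 0 i0 - a| by rewrite subr_gt0.
  near=> x; apply: height_active => //.
  have xp : `|x 0 i0 - p 0 i0| < a / 3 - `|p 0 i0 - a|.
    by near: x; exact: near_coord.
  rewrite -(subrKA (p 0 i0)); apply: le_lt_trans (ler_normD _ _) _; lra.
(* An active scale a at x satisfies a / 3 <= |p_0 - a| < |p_0| / 16 + a / 4,
   so a < 3/4 |p_0| and |p_0| < |p_0| / 16 + 5 a / 4 <= |p_0|. *)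
left; have e0 : 0 < `|p 0 i0| / 16 by rewrite divr_gt0 ?normr_gt0.
near=> x; apply: height_inactive => a sa; rewrite leNgt; apply/negP => xa.
have xp : `|x 0 i0 - p 0 i0| < `|p 0 i0| / 16 by near: x; exact: near_coord.
have pa : a / 3 <= `|p 0 i0 - a|.
  by rewrite leNgt; apply/negP => h; apply: none; exists a.
have h1 := ler_normD (p 0 i0 - x 0 i0) (x 0 i0 - a).
rewrite subrKA in h1.
have h2 := ler_normD (p 0 i0 - x 0 i0) (x 0 i0 - a + a).
rewrite !subrK in h2.
have h3 := ler_normD (x 0 i0 - a) a; rewrite subrK in h3.
have /andP[a0 _] := scale_itv sa; rewrite (gtr0_norm a0) in h3.
rewrite distrC in xp; lra.
Unshelve. all: by end_near. Qed.

End Assembly.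

(** * Local Hessians and curvature bounds *)

Lemma quadratically_flat (R : realType) (V W : normedModType R) (f : V -> W)
    (p : V) C : 0 <= C -> (forall h, `|f (h + p)| <= C * `|h| ^+ 2) ->
  differentiable f p /\ 'd f p = (fun=> 0) :> (V -> W).
Proof.
move=> C0 fC.
have fp : f p = 0.
  apply/eqP; rewrite -normr_le0; have := fC 0.
  by rewrite add0r normr0 expr0n mulr0.
pose z : {linear V -> W} := \0.
have zc : continuous z by move=> x; exact: cst_continuous.
have E : f \o shift p = cst (f p) + z +o_ 0 id.
  apply/eqaddoP => e e0.
  have C1 : 0 < C + 1 by rewrite ltr_wpDl.
  have e1 : 0 < e / (C + 1) by rewrite divr_gt0.
  near=> h; rewrite !fctE /= fp /= addr0 subr0.
  apply: le_trans (fC _) _.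
  have he : `|h| <= e / (C + 1) by near: h; apply: nbhs0_le.
  rewrite expr2 mulrA ler_wpM2r //.
  apply: (@le_trans _ _ (C * (e / (C + 1)))); first by rewrite ler_wpM2l.
  by rewrite mulrCA ler_piMr ?ltW // ltr_pdivrMr // mul1r ltrDl.
have D := diff_unique zc E.
by split; rewrite ?D //; apply/diff_locallyP; split; rewrite D.
Unshelve. all: by end_near. Qed.

Section Locality.
Context {R : realType} {n : nat}.
Implicit Types (f u : 'rV[R]_n -> R) (p : 'rV[R]_n).

Lemma near_near (P : 'rV[R]_n -> Prop) p :
  (\forall x \near p, P x) -> \forall x \near p, \forall y \near x, P y.
Proof. by move=> h; apply: nbhs_interior. Qed.

Lemma near_grad u f p : (\near p, u p = f p) -> \near p, grad u p = grad f p.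
Proof.
move=> /near_near uf; near=> x; apply/rowP => i; rewrite !mxE.
by apply: partial_near; near: x.
Unshelve. all: by end_near. Qed.

Lemma near_hessian u f p :
  (\near p, u p = f p) -> \near p, hessian u p = hessian f p.
Proof.
move=> /near_grad/near_near uf; near=> x; apply/matrixP => i j; rewrite !mxE.
apply: partial_near.
have : \near x, grad u x = grad f x by near: x.
by apply: filterS => y /rowP/(_ j); rewrite !mxE.
Unshelve. all: by end_near. Qed.

Definition smooth2 f : Prop :=
  [/\ forall x, differentiable f x, forall x, differentiable (grad f) x &
      continuous (hessian f)].

Lemma grad_jet f g : (forall x, has_grad f x (g x)) ->
  forall x, grad f x = \row_j g x j.
Proof. by move=> fg x; apply/rowP => j; rewrite !mxE; have [_ ->] := fg x. Qed.

Lemma hessian_jet f g (H : 'rV[R]_n -> 'I_n -> 'I_n -> R) :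
  (forall x, has_grad f x (g x)) ->
  (forall x j, has_grad (g ^~ j) x (fun i => H x i j)) ->
  forall x, hessian f x = \matrix_(i, j) H x i j.
Proof.
move=> fg gH x; apply/matrixP => i j; rewrite !mxE.
have [_ <-] := gH x j; congr (partial i _ x); apply/funext => y.
by have [_ ->] := fg y.
Qed.

Lemma smooth2_jet f g (H : 'rV[R]_n -> 'I_n -> 'I_n -> R) :
  (forall x, has_grad f x (g x)) ->
  (forall x j, has_grad (g ^~ j) x (fun i => H x i j)) ->
  (forall i j, continuous (fun x => H x i j)) -> smooth2 f.
Proof.
move=> fg gH cH; split=> x.
- by have [] := fg x.
- apply: differentiable_row => j.
  rewrite (_ : (fun y => _) = g ^~ j); first by have [] := gH x j.
  by apply/funext => y; rewrite (grad_jet fg) mxE.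
- apply: continuous_mx => i j; rewrite (_ : (fun y => _) = fun y => H y i j).
    exact: cH.
  by apply/funext => y; rewrite (hessian_jet fg gH) mxE.
Qed.

Lemma smooth2_local u f p : smooth2 f -> (\near p, u p = f p) ->
  [/\ differentiable u p, differentiable (grad u) p &
      {for p, continuous (hessian u)}].
Proof.
move=> [df dg cH] uf; have fu : \near p, f p = u p.
  by apply: filterS uf => x ->.
split; first exact: near_eq_differentiable fu (df p).
- exact: near_eq_differentiable (near_grad fu) (dg p).
- exact: near_eq_continuous (near_hessian fu) (cH p).
Qed.

(** This is what makes the height and its gradient differentiable on the hyperplane
where infinitely many bumps accumulate. *)
Lemma has_grad_flat f i0 C p : p 0 i0 = 0 ->
  (forall x, `|f x| <= C * x 0 i0 ^+ 2) -> has_grad f p (fun=> 0).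
Proof.
move=> p0 fC.
have C0 : 0 <= C.
  have := le_trans (normr_ge0 _) (fC (const_mx 1)).
  by rewrite mxE expr1n mulr1.
have [df D] : differentiable f p /\ 'd f p = (fun=> 0) :> ('rV[R]_n -> R).
  apply: (quadratically_flat C0) => h; apply: le_trans (fC _) _.
  rewrite mxE p0 addr0 ler_wpM2l // -real_normK ?num_real //.
  rewrite ler_pXn2r ?nnegrE //.
  rewrite [leRHS]/Num.Def.normr /= mx_normrE.
  exact: (le_bigmax _ (fun ij => `|h ij.1 ij.2|) (0, i0)).
by split=> // i; rewrite partialE // D.
Qed.

End Locality.

Section FormBounds.
Context {R : realType} {n : nat}.
Implicit Types (u : 'rV[R]_n -> R) (v w : 'rV[R]_n).

(** The projection of a tangent vector to the domain shortens it. *)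
Lemma coord_le_tangent_norm u x v i : `|v 0 i| <= tangent_norm u x v.
Proof.
have E : dot (v *m first_form u x) v = dot v v + dot v (grad u x) ^+ 2.
  rewrite /dot /first_form mulmxDr mulmx1 mulmxDl mxE; congr (_ + _).
  rewrite mulmxA -mulmxA mxE big_ord1 expr2; congr (_ * _).
  by rewrite !mxE; apply: eq_bigr => k _; rewrite !mxE mulrC.
rewrite /tangent_norm E -sqrtr_sqr ler_wsqrtr //.
rewrite dotE (bigD1 i) //= -expr2 -addrA lerDl addr_ge0 ?sqr_ge0 //.
by apply: sumr_ge0 => k _; rewrite -expr2 sqr_ge0.
Qed.

Lemma area_factor_ge1 u x : 1 <= area_factor u x.
Proof. by rewrite -[leLHS]sqrtr1 ler_wsqrtr // lerDl dot_ge0. Qed.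

Lemma dot_mulmxE v (H : 'M[R]_n) w :
  dot (v *m H) w = \sum_i \sum_j v 0 i * H i j * w 0 j.
Proof.
rewrite dotE exchange_big /=; apply: eq_bigr => j _.
by rewrite mxE mulr_suml.
Qed.

Lemma norm_dot_mulmx v (H : 'M[R]_n) w a b C :
  (forall i, `|v 0 i| <= a) -> (forall i, `|w 0 i| <= b) ->
  (forall i j, `|H i j| <= C) ->
  `|dot (v *m H) w| <= n%:R ^+ 2 * (C * a * b).
Proof.
move=> va wb HC; rewrite dot_mulmxE.
apply: le_trans (ler_norm_sum _ _ _) _.
apply: (@le_trans _ _ (\sum_(i < n) \sum_(j < n) C * a * b)); last first.
  by rewrite !sumr_const card_ord -mulrnA -[leLHS]mulr_natl natrM -expr2.
apply: ler_sum => i _; apply: le_trans (ler_norm_sum _ _ _) _.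
apply: ler_sum => j _; rewrite !normrM [C * a]mulrC.
by rewrite ler_pM ?mulr_ge0 // ler_pM.
Qed.

Lemma second_form_bound u C : (forall x i j, `|hessian u x i j| <= C) ->
  forall x v w, `|dot (v *m second_form u x) w| <=
    (n%:R ^+ 2 * C) * tangent_norm u x v * tangent_norm u x w.
Proof.
move=> HC x v w.
have := norm_dot_mulmx (coord_le_tangent_norm u x v)
  (coord_le_tangent_norm u x w) (HC x).
have A1 := area_factor_ge1 u x; have A0 := area_factor_gt0 u x.
rewrite !mulrA; apply: le_trans.
apply: (le_trans _ (_ : `|(area_factor u x)^-1 * dot (v *m hessian u x) w| <= _)).
  by rewrite -(dot_second_form u x v w).
rewrite normrM ler_piMl // normfV invf_le1 ?normr_gt0 ?lt0r_neq0 //.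
by rewrite (ger0_norm (ltW A0)).
Qed.

(** The trace enters linearly and the full Hessian only multiplied by the square of
the gradient. *)
Lemma mean_curvature_bound u x T B C :
  differentiable (grad u) x -> `|\tr (hessian u x)| <= T ->
  (forall i, `|grad u x 0 i| <= B) ->
  (forall i j, `|hessian u x i j| <= C) ->
  `|mean_curvature u x| <= T + n%:R ^+ 2 * (C * B * B).
Proof.
move=> dg hT hB hC; rewrite (mean_curvatureE dg).
have A1 := area_factor_ge1 u x; have A0 := area_factor_gt0 u x.
rewrite normrM normfV (ger0_norm (ltW A0)).
apply: (@le_trans _ _ `|\tr (inv_first_form (grad u x) *m hessian u x)|).
  by rewrite ler_piMl // invf_le1.
rewrite /inv_first_form mulmxBl mul1mx raddfB /= -scalemxAl mxtraceZ.
apply: le_trans (ler_normB _ _) _; apply: lerD => //.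
apply: le_trans (norm_dot_mulmx hB hB hC).
have -> : \tr ((grad u x)^T *m grad u x *m hessian u x) =
    dot (grad u x *m hessian u x) (grad u x).
  by rewrite -mulmxA mxtrace_mulC /mxtrace big_ord1.
rewrite normrM ler_piMl // normfV invf_le1.
  by rewrite ger0_norm ?addr_ge0 ?dot_ge0 // lerDl dot_ge0.
by rewrite normr_gt0 lt0r_neq0 // ltr_pwDl // dot_ge0.
Qed.

Lemma continuous_mean_curvature_at u x :
  (\forall y \near x, differentiable (grad u) y) ->
  {for x, continuous (hessian u)} -> {for x, continuous (mean_curvature u)}.
Proof.
move=> dgn cH; have dg := nbhs_singleton dgn.
have cg := differentiable_continuous dg.
have [dA _] := has_grad_area dg; have cA := differentiable_continuous dA.
have A0 y : area_factor u y != 0 by rewrite lt0r_neq0 // area_factor_gt0.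
have cAV : {for x, continuous (fun y => (area_factor u y)^-1)} by exact: continuousV.
have cF : {for x, continuous (fun y => inv_first_form (grad u y))}.
  have c2 : {for x, continuous (fun y => (1 + dot (grad u y) (grad u y))^-1)}.
    rewrite (_ : (fun y => _) =
      fun y => (area_factor u y)^-1 * (area_factor u y)^-1); last first.
      by apply/funext => y; rewrite -area_factor_sqr expr2 invfM.
    exact: continuousM.
  apply: continuousB; first exact: cst_continuous.
  exact: (cvgZ c2 (continuous_mulmx (continuous_trmx cg) cg)).
have cM := continuous_mulmx cF cH.
have ct : {for x, continuous (fun y => \tr (inv_first_form (grad u y) *m hessian u y))}.
  apply: continuous_sum_at => i.
  exact: continuous_comp cM (@coord_continuous _ _ _ i i _).
apply: near_eq_continuous (continuousM cAV ct).
by near=> y; rewrite mean_curvatureE //; near: y.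
Unshelve. all: by end_near. Qed.

End FormBounds.

(** * The surface *)

Section Surface.
Context {R : realType} {n : nat}.
Variables (i0 i1 : 'I_n).
Hypothesis i01 : i0 != i1.
Implicit Types (x p : 'rV[R]_n) (a : R).

Let u : 'rV[R]_n -> R := height_fun i0 i1.

Lemma smooth2_bump_at a : 0 < a -> smooth2 (bump_at i0 i1 a).
Proof.
move=> a0; have d0 := core_gt0 a0.
apply: (smooth2_jet (has_grad_bump i0 i1 a d0) (has_grad_bump_grad i0 i1 a d0)).
by move=> i j; exact: continuous_bump_hess.
Qed.

(** The support radius r of the bump satisfies r <= a^2 / 4 and a <= 2 |p_0|, which
turns the bounds on the bump into bounds in terms of p_0. *)
Lemma height_model p : p 0 i0 != 0 -> exists f : 'rV[R]_n -> R,
  [/\ smooth2 f, \near p, u p = f p &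
   [/\ `|f p| <= p 0 i0 ^+ 2,
       forall j, `|grad f p 0 j| <= 7 * p 0 i0 ^+ 2,
       forall i j, `|hessian f p i j| <= 101 &
       `|\tr (hessian f p)| <= n%:R * (200 * `|p 0 i0|)]].
Proof.
move=> p0; have [near0|[a [sa ap near_a]]] := height_local i1 p0.
  have hg x : has_grad (fun=> 0 : R) x (fun _ : 'I_n => 0) by exact: has_grad_cst.
  have hh x (j : 'I_n) :
    has_grad (fun _ : 'rV[R]_n => 0 : R) x (fun _ : 'I_n => 0) by exact: hg.
  have gE := grad_jet hg.
  have hE := hessian_jet (g := fun _ _ => 0) (H := fun _ _ _ => 0) hg hh.
  exists (fun=> 0); split=> //.
    by apply: (smooth2_jet (g := fun _ _ => 0) (H := fun _ _ _ => 0) hg hh) =>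
      i j x; exact: cst_continuous.
  split=> [||i j|].
  - by rewrite normr0 sqr_ge0.
  - by move=> j; rewrite gE mxE normr0 mulr_ge0 // sqr_ge0.
  - by rewrite hE mxE normr0.
  - rewrite /mxtrace big1 ?normr0 ?mulr_ge0 // => i _; by rewrite hE mxE.
have /andP[a0 a1] := scale_itv sa; have d0 := core_gt0 a0.
have gE := grad_jet (has_grad_bump i0 i1 a d0).
have hE := hessian_jet (has_grad_bump i0 i1 a d0) (has_grad_bump_grad i0 i1 a d0).
have r0 := radius_ge0 a.
have rp : a ^+ 2 / 4 <= p 0 i0 ^+ 2.
  rewrite ler_pdivrMr // -(real_normK (num_real (p 0 i0))).
  have := normr_ge0 (p 0 i0); move: (`|p 0 i0|) ap => q; nra.
exists (bump_at i0 i1 a); split=> //; first exact: smooth2_bump_at.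
split=> [|j|i j|].
- apply: le_trans (norm_bump i0 i1 a0 d0 p r0 (core_expR a)) _.
  rewrite -[leRHS](real_normK (num_real (p 0 i0))) ler_pXn2r ?nnegrE //.
  have := radius_le (scale_itv sa); move: (a ^+ 2) (`|_|) ap => b q; lra.
- rewrite gE mxE.
  apply: le_trans (norm_bump_grad i01 a0 a1 d0 p j r0 (core_expR a)) _.
  by rewrite ler_pM2l.
- by rewrite hE mxE; exact: norm_bump_hess.
- rewrite /mxtrace; under eq_bigr do rewrite hE mxE.
  apply: le_trans (norm_bump_trace i01 a0 a1 d0 p) _.
  by rewrite ler_wpM2l //; lra.
Qed.

Lemma height_eq0 p : p 0 i0 = 0 -> u p = 0.
Proof.
move=> p0; apply: height_inactive => a sa; have /andP[a0 _] := scale_itv sa.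
rewrite p0 sub0r normrN gtr0_norm //; lra.
Qed.

Lemma height_bound x : `|u x| <= 1 * x 0 i0 ^+ 2.
Proof.
rewrite mul1r; have [x0|x0] := eqVneq (x 0 i0) 0.
  by rewrite height_eq0 // normr0 sqr_ge0.
have [f [_ uf [hf _ _ _]]] := height_model x0.
by rewrite (nbhs_singleton uf).
Qed.

Lemma has_grad_height0 p : p 0 i0 = 0 -> has_grad u p (fun=> 0).
Proof. by move=> p0; exact: has_grad_flat p0 height_bound. Qed.

Lemma grad_height_bound x j : `|grad u x 0 j| <= 7 * x 0 i0 ^+ 2.
Proof.
have [x0|x0] := eqVneq (x 0 i0) 0.
  have [_ E] := has_grad_height0 x0.
  by rewrite mxE E normr0 mulr_ge0 // sqr_ge0.
have [f [_ uf [_ hf _ _]]] := height_model x0.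
by rewrite (nbhs_singleton (near_grad uf)).
Qed.

Lemma hessian_height0 p : p 0 i0 = 0 ->
  differentiable (grad u) p /\ hessian u p = 0.
Proof.
move=> p0; have h j : has_grad (fun y => grad u y 0 j) p (fun=> 0).
  by apply: has_grad_flat p0 _ => x; exact: grad_height_bound.
have dg : differentiable (grad u) p.
  by apply: differentiable_row => j; have [] := h j.
split=> //; apply/matrixP => i j; rewrite [RHS]mxE.
by have [_ <-] := has_grad_partial j dg; have [_ ->] := h j.
Qed.

Lemma height_twice_differentiable : twice_differentiable_on setT u.
Proof.
move=> p _; have [p0|p0] := eqVneq (p 0 i0) 0.
  by have [? _] := has_grad_height0 p0; have [? _] := hessian_height0 p0.
have [f [sf uf _]] := height_model p0.
by have [] := smooth2_local sf uf.
Qed.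

Lemma hessian_height_bound x i j : `|hessian u x i j| <= 101.
Proof.
have [x0|x0] := eqVneq (x 0 i0) 0.
  by have [_ ->] := hessian_height0 x0; rewrite mxE normr0.
have [f [_ uf [_ _ hf _]]] := height_model x0.
by rewrite (nbhs_singleton (near_hessian uf)).
Qed.

Lemma trace_height_bound x : `|\tr (hessian u x)| <= n%:R * (200 * `|x 0 i0|).
Proof.
have [x0|x0] := eqVneq (x 0 i0) 0.
  have [_ ->] := hessian_height0 x0.
  by rewrite raddf0 normr0 mulr_ge0 // mulr_ge0.
have [f [_ uf [_ _ _ hf]]] := height_model x0.
by rewrite (nbhs_singleton (near_hessian uf)).
Qed.

Lemma mean_curvature_height_bound x :
  `|mean_curvature u x| <= n%:R * (200 * `|x 0 i0|) +
    n%:R ^+ 2 * (101 * (7 * x 0 i0 ^+ 2) * (7 * x 0 i0 ^+ 2)).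
Proof.
have [_ dg] := @height_twice_differentiable x I.
exact: mean_curvature_bound dg (trace_height_bound x) (grad_height_bound x)
  (hessian_height_bound x).
Qed.

(** On the hyperplane the bound on the mean curvature vanishes and is continuous. *)
Lemma continuous_mean_curvature_height : continuous (mean_curvature u).
Proof.
move=> p; have [p0|p0] := eqVneq (p 0 i0) 0; last first.
  have [f [sf uf _]] := height_model p0.
  apply: continuous_mean_curvature_at; last by have [] := smooth2_local sf uf.
  by near=> y; have [] := @height_twice_differentiable y I.
pose K (t : R) := n%:R * (200 * `|t|) +
  n%:R ^+ 2 * (101 * (7 * t ^+ 2) * (7 * t ^+ 2)).
have K0 : K 0 = 0 by rewrite /K normr0 expr0n !mulr0 addr0.
have cK : continuous K.
  move=> t; have c2 : {for t, continuous (fun t : R => 7 * t ^+ 2)}.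
    by apply: continuousM; [exact: cst_continuous|exact: exprn_continuous].
  have cc (c : R) : {for t, continuous (fun=> c)} by exact: cst_continuous.
  have cN : {for t, continuous (fun t : R => `|t|)} by exact: norm_continuous.
  exact: (continuousD (continuousM (cc n%:R) (continuousM (cc 200) cN))
    (continuousM (cc (n%:R ^+ 2)) (continuousM (continuousM (cc 101) c2) c2))).
have cKp : {for p, continuous (fun x : 'rV[R]_n => K (x 0 i0))}.
  exact: continuous_comp (@coord_continuous _ _ _ 0 i0 p) (cK _).
have MC0 : mean_curvature u p = 0.
  apply/eqP; rewrite -normr_le0; have := mean_curvature_height_bound p.
  by rewrite -/(K (p 0 i0)) p0 K0.
have MCp : mean_curvature u x @[x --> p] --> (0 : R); last by rewrite -MC0 in MCp.
apply/(cvgrPdist_lt (FF := nbhs_filter p)) => e e0.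
have /cvgrPdist_lt/(_ e e0) := cKp; rewrite p0 K0; apply: filterS => x.
rewrite !sub0r !normrN; apply: le_lt_trans.
exact: le_trans (mean_curvature_height_bound x) (ler_norm _).
Unshelve. all: by end_near. Qed.

Lemma hessian_height_scale a : scale a ->
  hessian u (a *: delta_mx 0 i0) i0 i1 = 1.
Proof.
move=> sa; have /andP[a0 _] := scale_itv sa; have d0 := core_gt0 a0.
set x := a *: _.
have x0 : x 0 i0 = a by rewrite !mxE !eqxx mulr1.
have x1 : x 0 i1 = 0 by rewrite !mxE eqxx eq_sym (negbTE i01) mulr0.
have uf : \near x, u x = bump_at i0 i1 a x.
  have a3 : 0 < a / 3 by rewrite divr_gt0.
  near=> y; apply: height_active => //; rewrite -{1}x0.
  by near: y; exact: near_coord.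
rewrite (nbhs_singleton (near_hessian uf)).
rewrite (hessian_jet (has_grad_bump i0 i1 a d0) (has_grad_bump_grad i0 i1 a d0)).
by rewrite mxE bump_hess_center.
Unshelve. all: by end_near. Qed.

(** Along the centres of the bumps the mixed derivative is constantly 1. *)
Lemma hessian_height_discontinuous : ~ {for 0, continuous (hessian u)}.
Proof.
move=> cH; have [_ H0] := hessian_height0 (p := 0) (mxE _ _ _ _).
have c01 : {for 0, continuous (fun x => hessian u x i0 i1)}.
  exact: continuous_comp cH (@coord_continuous _ _ _ i0 i1 _).
have ch : (fun k => hessian u (2^-1 ^+ k *: delta_mx 0 i0) i0 i1) @ \oo --> (0 : R).
  have e0 : (2^-1 ^+ k *: (delta_mx 0 i0 : 'rV[R]_n)) @[k --> \oo] --> (0 : 'rV[R]_n).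
    rewrite -[X in _ --> X](scale0r (delta_mx 0 i0)).
    apply: cvgZr_tmp; apply: cvg_expr.
    by rewrite ger0_norm ?invr_ge0 // invf_lt1 ?ltr1n.
  move: c01; rewrite /prop_for /continuous_at H0 mxE => c01.
  exact: cvg_comp e0 c01.
have c1 : (fun k => hessian u (2^-1 ^+ k *: delta_mx 0 i0) i0 i1) @ \oo --> (1 : R).
  rewrite (_ : (fun k => _) = cst 1); first exact: cvg_cst.
  by apply/funext => k; rewrite hessian_height_scale //; exists k.
have /eqP : (0 : R) = 1 by exact: cvg_unique _ ch c1.
by rewrite eq_sym oner_eq0.
Qed.

End Surface.

Theorem corollary1p5 (R : realType) (n : nat) (n_ge2 : (2 <= n)%N) :
  exists S : set 'rV[R]_(n + 1),
    [/\ twice_differentiable_hypersurface S,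
        ~ C2_hypersurface S,
        continuous_mean_curvature S &
        bounded_second_form S].
Proof.
pose i0 : 'I_n := Ordinal (ltnW n_ge2); pose i1 : 'I_n := Ordinal n_ge2.
have i01 : i0 != i1 by [].
have du := height_twice_differentiable (R := R) i01.
exists (graph_of (height_fun i0 i1)); split.
- exact: graph_twice_differentiable.
- refine (graph_not_C2 du _); exact: hessian_height_discontinuous.
- exact: graph_mean_curvature du (continuous_mean_curvature_height i01).
- refine (graph_bounded du _); exact: second_form_bound (hessian_height_bound i01).
Qed.
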